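(* Let $t$ be a nonnegative integer and let $k$ be a positive integer. For each prime $p > 2k+3$ there exists a group $P$ of order $p^{2(t+k+2)}$ such that the only nontrivial reduced homology groups of $\Delta\mathcal{A}_{\geq 2}(P)$ are $\widetilde{H}_t(\Delta\mathcal{A}_{\geq 2}(P))$ and $\widetilde{H}_{k+t}(\Delta\mathcal{A}_{\geq 2}(P))$ (and both of these are nontrivial).
   Context: For a finite $p$-group $P$, $\mathcal{A}_{\geq 2}(P)$ is the set of elementary abelian subgroups of $P$ having order at least $p^2$, partially ordered by inclusion. For a poset $\mathcal{P}$, the order complex $\Delta\mathcal{P}$ is the abstract simplicial complex whose $k$-dimensional faces are the chains $x_0 < \cdots < x_k$ in $\mathcal{P}$. $\widetilde{H}_i$ denotes reduced integral homology. *)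

(* Defs.v *)
From HB Require Import structures.
From mathcomp Require Import all_boot all_order all_algebra all_fingroup all_solvable.
From mathcomp Require Import boolp.

Set Implicit Arguments.
Unset Strict Implicit.
Unset Printing Implicit Defensive.

Import GRing.Theory Num.Theory.
Local Open Scope ring_scope.

(* A finite abstract simplicial complex is the set K of its faces, including
   the empty face, so that the chain complex below is the augmented one.
   The relation lt is meant to restrict to a strict total order on every face;
   it fixes the orientation of the faces. *)
Section SimplicialHomology.
Variables (T : finType) (lt : rel T) (K : {set {set T}}).

Definition is_simplicial_complex : Prop :=
  set0 \in K /\ forall s u : {set T}, u \subset s -> s \in K -> u \in K.

Definition orients_faces : Prop := forall s, s \in K ->
  {in s, irreflexive lt} /\
  {in s &, forall x y, x != y -> lt x y = ~~ lt y x} /\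
  {in s & &, transitive lt}.

(* For x_0 < ... < x_n the boundary is
     \sum_j (-1) ^+ j *: [x_0, ..., x_(j-1), x_(j+1), ..., x_n];
   the face s receives a contribution from every x |: s with x \notin s, and
   the position j of x in x |: s is the number of y in s below x. *)
Definition boundary (c : {ffun {set T} -> int}) : {ffun {set T} -> int} :=
  [ffun s : {set T} =>
    \sum_(x | x \notin s) (-1) ^+ #|[set y in s | lt y x]| * c (x |: s)].

(* The i-dimensional faces have i + 1 elements, for i : int, i >= -1. *)
Definition chains (i : int) : {pred {ffun {set T} -> int}} :=
  fun c => [forall s, (c s != 0) ==> (s \in K) && (#|s|%:Z == i + 1)].

Definition cycles (i : int) : {pred {ffun {set T} -> int}} :=
  fun c => (c \in chains i) && (boundary c == 0).

Lemma boundaryB : {morph boundary : c1 c2 / c1 - c2}.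
Proof.
move=> c1 c2; apply/ffunP => s; rewrite !ffunE -sumrB.
by apply: eq_bigr => x _; rewrite !ffunE mulrBr.
Qed.

HB.instance Definition _ :=
  GRing.isZmodMorphism.Build {ffun {set T} -> int} {ffun {set T} -> int}
    boundary boundaryB.

Lemma chains_zmod_closed i : zmod_closed (chains i).
Proof.
split=> [|c1 c2 /forallP h1 /forallP h2].
  by apply/forallP => s; rewrite ffunE eqxx.
apply/forallP => s; apply/implyP; rewrite !ffunE.
have [-> |n1 _] := eqVneq (c1 s) 0; last exact: (implyP (h1 s)).
by rewrite sub0r oppr_eq0; exact: (implyP (h2 s)).
Qed.

HB.instance Definition _ i :=
  GRing.isZmodClosed.Build {ffun {set T} -> int} (chains i)
    (chains_zmod_closed i).

Lemma cycles_zmod_closed i : zmod_closed (cycles i).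
Proof.
split=> [|c1 c2 /andP[h1 /eqP e1] /andP[h2 /eqP e2]]; apply/andP; split.
- exact: rpred0.
- by rewrite raddf0.
- exact: rpredB.
- by rewrite raddfB /= e1 e2 subrr.
Qed.

HB.instance Definition _ i :=
  GRing.isZmodClosed.Build {ffun {set T} -> int} (cycles i)
    (cycles_zmod_closed i).

Record cycle_group (i : int) := Cycle {
  cycle_val : {ffun {set T} -> int};
  _ : cycle_val \in cycles i }.

HB.instance Definition _ i := [isSub for @cycle_val i].
HB.instance Definition _ i := [Choice of cycle_group i by <:].
HB.instance Definition _ i := [SubChoice_isSubZmodule of cycle_group i by <:].

Definition boundaries (i : int) : {pred cycle_group i} :=
  fun z => `[< exists2 b, b \in chains (i + 1) & \val z = boundary b >].

Lemma boundaries_zmod_closed i : zmod_closed (@boundaries i).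
Proof.
split=> [|z1 z2 /asboolP[b1 h1 e1] /asboolP[b2 h2 e2]]; apply/asboolP.
  by exists 0; rewrite ?rpred0 // raddf0 raddf0.
by exists (b1 - b2); [exact: rpredB | rewrite !raddfB /= e1 e2].
Qed.

HB.instance Definition _ i :=
  GRing.isZmodClosed.Build (cycle_group i) (@boundaries i)
    (boundaries_zmod_closed i).

Definition reduced_homology (i : int) : zmodType :=
  @Quotient.quot (cycle_group i) (@boundaries i).

Lemma boundary_cycle (i : int) (b : {ffun {set T} -> int}) :
  is_simplicial_complex -> orients_faces ->
  b \in chains (i + 1) -> boundary b \in cycles i.
Proof.
move=> [_ Kdown] Kor /forallP hb; apply/andP; split.
  apply/forallP => s; apply/implyP => nz.
  have [x xs bx] : exists2 x, x \notin s & b (x |: s) != 0.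
    have [/existsP[x /andP[]]|/existsPn h] :=
      boolP [exists x, (x \notin s) && (b (x |: s) != 0)]; first by exists x.
    case/eqP: nz; rewrite ffunE big1 // => x xs.
    by move: (h x); rewrite xs negbK => /eqP ->; rewrite mulr0.
  have /andP[Ks /eqP] := implyP (hb _) bx.
  rewrite cardsU1 xs add1n -addn1 PoszD => /addIr ->.
  by rewrite eqxx (Kdown _ _ (subsetUr [set x] s) Ks).
apply/eqP/ffunP => s; rewrite [RHS]ffunE.
pose P x y := [&& x \notin s, y \notin s & y != x].
pose n x := #|[set z in s | lt z x]|.
pose F x y := (-1) ^+ (n x + (lt x y + n y)) * b (x |: (y |: s)) : int.
have E : boundary (boundary b) s = \sum_x \sum_(y | P x y) F x y.
  rewrite ffunE big_mkcond; apply: eq_bigr => x _.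
  case: ifPn => xs; last by rewrite big_pred0 // => y; rewrite /P (negPf xs).
  rewrite ffunE big_distrr /=; apply: eq_big => [y|y].
    by rewrite !inE negb_or /P xs andbC.
  rewrite !inE negb_or => /andP[nyx ys]; rewrite mulrA -exprD setUCA.
  congr (_ ^+ (_ + _) * _); rewrite /n; case: (boolP (lt x y)) => lxy.
    rewrite (_ : [set z in _ | _] = x |: [set z in s | lt z y]).
      by rewrite cardsU1 inE (negPf xs).
    by apply/setP => z; rewrite !inE; case: eqP => // ->; rewrite lxy.
  rewrite add0n; congr #|pred_of_set _|; apply/setP => z; rewrite !inE.
  by case: eqP => // ->; rewrite (negPf lxy) (negPf xs).
have S : \sum_x \sum_(y | P x y) F x y = - \sum_x \sum_(y | P x y) F x y.
  rewrite -sumrN.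
  under eq_bigr do rewrite big_mkcond.
  rewrite exchange_big /=; apply: eq_bigr => x _.
  rewrite -big_mkcond /= -sumrN; apply: eq_big => [y|y].
    by rewrite /P eq_sym andbCA.
  case/and3P=> ys xs nxy; rewrite /F setUCA.
  have [-> |bn] := eqVneq (b (x |: (y |: s))) 0; first by rewrite !mulr0 oppr0.
  have /andP[Ks _] := implyP (hb _) bn.
  have [_ [tot _]] := Kor _ Ks.
  rewrite (tot y x) ?inE ?eqxx ?orbT //; last by rewrite eq_sym.
  rewrite -mulNr; congr (_ * _); case: (lt x y) => /=.
    by rewrite add0n add1n addnS exprS mulN1r opprK addnC.
  by rewrite add0n add1n addnS exprS mulN1r addnC.
by rewrite E; move/eqP: S; rewrite -addr_eq0 -mulr2n mulrn_eq0 /= => /eqP.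
Qed.

Lemma reduced_homology_nontrivialP (i : int) :
  (exists h : reduced_homology i, h != 0) <->
  (exists2 z, z \in cycles i &
     ~ exists2 b, b \in chains (i + 1) & z = boundary b).
Proof.
have piE0 (z : cycle_group i) :
    (\pi_(reduced_homology i)%qT z == 0) = (z \in @boundaries i).
  rewrite -(raddf0 \pi_(reduced_homology i)%qT) -[z in RHS]subr0.
  by rewrite Quotient.idealrBE.
split=> [[h]|[z zZ zB]].
  elim/quotW: h => -[z zZ]; rewrite piE0 => /negP nB; exists z => // zB.
  by apply: nB; apply/asboolP.
exists (\pi_(reduced_homology i)%qT (Cycle zZ)); rewrite piE0.
by apply/negP => /asboolP.
Qed.

End SimplicialHomology.

Section OrderComplex.
Variables (T : finType) (lt : rel T) (A : {set T}).

(* The chains of the set A, partially ordered by the strict order lt. *)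
Definition order_complex : {set {set T}} :=
  [set s : {set T} | (s \subset A) &&
     [forall x in s, forall y in s, [|| x == y, lt x y | lt y x]]].

Lemma order_complex_simplicial : is_simplicial_complex order_complex.
Proof.
split=> [|s u us]; rewrite !inE ?sub0set.
  by apply/forall_inP => x; rewrite inE.
case/andP=> sA /forall_inP h; rewrite (subset_trans us sA).
apply/forall_inP => x xu; apply/forall_inP => y yu.
by move/forall_inP: (h x (subsetP us x xu)); apply; apply: (subsetP us).
Qed.

Lemma order_complex_oriented :
  irreflexive lt -> transitive lt -> orients_faces lt order_complex.
Proof.
move=> irr tr s; rewrite inE => /andP[_ /forall_inP h]; split=> [x _|].
  exact: irr.
split=> [x y xs ys nxy|]; last by move=> y x z _ _ _; apply: tr.
move/forall_inP/(_ y ys): (h x xs); rewrite (negPf nxy) /=.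
case: (boolP (lt x y)) => lxy /=; last by move=> ->.
by move=> _; apply/esym/negP => lyx; move: (tr _ _ _ lxy lyx); rewrite irr.
Qed.

End OrderComplex.

Definition group_proper (gT : finGroupType) : rel {group gT} :=
  fun E F => E \proper F.

Lemma group_proper_orients (gT : finGroupType) (A : {set {group gT}}) :
  orients_faces (@group_proper gT) (order_complex (@group_proper gT) A).
Proof.
apply: order_complex_oriented => [E|F E G]; first exact: properxx.
exact: proper_trans.
Qed.

(* Meant for P a p-group, where every elementary abelian subgroup is p.-abelem. *)
Definition A_ge2 (gT : finGroupType) (p : nat) (P : {group gT}) :
    {set {group gT}} :=
  [set E in 'E_p(P)%g | (p ^ 2 <= #|E|)%N].

Definition Delta_A_ge2 (gT : finGroupType) (p : nat) (P : {group gT}) :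
    {set {set {group gT}}} :=
  order_complex (@group_proper gT) (A_ge2 p P).

Definition H_A_ge2 (gT : finGroupType) (p : nat) (P : {group gT}) (i : int) :
    zmodType :=
  reduced_homology (@group_proper gT) (Delta_A_ge2 p P) i.

(* Main.v *)
Require Import Defs.
From mathcomp Require Import all_boot all_order all_algebra all_fingroup all_solvable.
From HB Require Import structures.
From mathcomp Require Import boolp zify ring.

Set Implicit Arguments.
Unset Strict Implicit.
Unset Printing Implicit Defensive.

Import GRing.Theory Num.Theory.
Local Open Scope ring_scope.

(** Let m = 2k + 2 < p. The group P is the extension, by the translations
  f(X) |-> f(X + a) with a in F_p, of a Heisenberg group Y of order
  p^(1 + 2(k+t+1)) whose elements are the pairs of a polynomial f of degree
  at most m and a vector of a symplectic space W of dimension 2t. The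
  commutator on Y is twice an alternating form which on polynomials is
  sum_i (-1)^i f^(i+1) g^(m-i); this sum has zero derivative, hence is a
  constant and does not change when f and g are both translated. The constants
  form the centre Z of Y, of order p. Since the translations form a group
  isomorphic to F_p, elements of order p outside Y come for free.

  Adjoining Z to elementary abelian subgroups shows that A_{>=2}(P) has the
  homology of the poset T of the elementary abelian E with Z < E <= P
  (A_ge2_exactE). The part of T below Y is the poset of nonzero isotropic
  subspaces of the symplectic space Y/Z, whose homology lives in degree k + t
  only (symplectic_homology). An E in T that is not below Y is added to that
  part after all the larger ones have been added; the homology changes
  according to the link of E. If E meets Y in more than Z, the link is a cone
  with apex E :&: Y. Otherwise E = Z<x> for an x of order p outside Y, and the
  link consists of the elementary abelian subgroups of C_P(x) above E. Let A
  be the group of polynomials of degree at most one. If x centralizes A, the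
  link contracts by F <= FA >= EA. If it does not, C_Y(x) is isomorphic
  to the Heisenberg group of W, so the link has the homology of the poset of
  nonzero isotropic subspaces of W, in degree t - 1 only. Adding such an E creates
  homology in degree t and leaves the other degrees alone; the translation by 1
  is an x of this kind (attachment_homology).

  All homological computations use three elementary facts on adding one
  vertex to a simplicial complex (exact_add_vertex, nonexact_new_vertex and
  nonexact_old_vertex), that is, the parts of a Mayer-Vietoris sequence that
  concern vanishing. They are applied to posets whose elements are added one
  at a time, larger ones first (extend_ind). *)

(** * Homology of a poset under the addition of elements *)

Lemma split_subset (T : finType) (S A : {set T}) :
  S \subset A -> A = S :|: A :\: S /\ [disjoint S & A :\: S].
Proof.
move=> /setUidPr SA; rewrite -setI_eq0 setDE setICA setICr setI0.
by rewrite setUIr setUCr setIT SA.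
Qed.

Section PosetHomology.
Variables (T : finType) (lt : rel T).
Hypotheses (lt_irr : irreflexive lt) (lt_trans : transitive lt).
Implicit Types (A S N : {set T}) (s : {set T}) (e : T) (i : int).
Implicit Types (c d : {ffun {set T} -> int}).

Local Notation Delta := (order_complex lt).
Local Notation bd := (boundary lt).

Definition exact_at S i : Prop :=
  forall z, z \in cycles lt (Delta S) i ->
    exists2 b, b \in chains (Delta S) (i + 1) & z = bd b.

Lemma homology_nontrivialE S i :
  (exists h : reduced_homology lt (Delta S) i, h != 0) <-> ~ exact_at S i.
Proof.
rewrite reduced_homology_nontrivialP; split=> [[z zZ zB] ex|].
  by apply: zB; apply: ex.
by move=> /existsNP[z /not_implyP[zZ zB]]; exists z.
Qed.

Lemma faceP A s :
  reflect (s \subset A /\ {in s &, forall x y, [|| x == y, lt x y | lt y x]})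
          (s \in Delta A).
Proof.
rewrite inE; apply: (iffP andP) => -[sA h]; split=> //.
  by move=> x y xs ys; move/forall_inP: h => /(_ x xs)/forall_inP; apply.
by apply/forall_inP => x xs; apply/forall_inP => y; apply: h.
Qed.

Lemma chainsP A i c :
  reflect (forall s, c s != 0 -> s \in Delta A /\ #|s|%:Z = i + 1)
          (c \in chains (Delta A) i).
Proof.
apply: (iffP forallP) => h s.
  by move=> nz; have /andP[-> /eqP->] := implyP (h s) nz.
by apply/implyP => /h[-> ->]; rewrite eqxx.
Qed.

Lemma bd_bd A i c : c \in chains (Delta A) i -> bd (bd c) = 0.
Proof.
move=> cA; suff /andP[_ /eqP//] : bd c \in cycles lt (Delta A) (i - 1).
apply: boundary_cycle; last by rewrite subrK.
  exact: order_complex_simplicial.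
exact: order_complex_oriented.
Qed.

Lemma cyclesP A i c :
  reflect (c \in chains (Delta A) i /\ bd c = 0)
          (c \in cycles lt (Delta A) i).
Proof. by apply: (iffP andP) => -[? /eqP]. Qed.

(** The order complex of the elements comparable with e is the link of e in
  the order complex of e |: A. A chain c of the latter splits into its part
  del e c away from e and its link part lk e c; the sign in lk is the position
  of e in the face, and cone e is the matching inverse of lk e. *)
Definition link A e := [set s in A | lt s e || lt e s].

Definition del e c : {ffun {set T} -> int} :=
  [ffun s : {set T} => if e \in s then 0 else c s].

Definition lk e c : {ffun {set T} -> int} :=
  [ffun s : {set T} =>
    if e \in s then 0 else (-1) ^+ #|[set y in s | lt y e]| * c (e |: s)].

Definition cone e c : {ffun {set T} -> int} :=
  [ffun s : {set T} =>
    if e \in s then (-1) ^+ #|[set y in s | lt y e]| * c (s :\ e) else 0].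

Lemma delD e c d : del e (c + d) = del e c + del e d.
Proof. by apply/ffunP=> s; rewrite !ffunE; case: ifP; rewrite ?addr0. Qed.

Lemma lkD e c d : lk e (c + d) = lk e c + lk e d.
Proof.
by apply/ffunP=> s; rewrite !ffunE; case: ifP; rewrite ?addr0 ?mulrDr.
Qed.

Lemma lkN e c : lk e (- c) = - lk e c.
Proof.
by apply/ffunP=> s; rewrite !ffunE; case: ifP; rewrite ?oppr0 ?mulrN.
Qed.

Lemma del_lk_inj e c d : del e c = del e d -> lk e c = lk e d -> c = d.
Proof.
move=> Ed El; apply/ffunP => s; have [es|es] := boolP (e \in s).
  move/ffunP/(_ (s :\ e)): El; rewrite !ffunE !inE eqxx /= setD1K //.
  by move/(can_inj (signrMK _)).
by move/ffunP/(_ s): Ed; rewrite !ffunE (negPf es).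
Qed.

Lemma del_bd e c : del e (bd c) = bd (del e c) + lk e c.
Proof.
apply/ffunP => s; rewrite !ffunE; case: ifPn => es.
  rewrite addr0 big1 // => x _.
  by rewrite ffunE in_setU1 es orbT mulr0.
rewrite (bigD1 e) //= addrC (bigD1 (P := fun x => x \notin s) e) //=.
rewrite ffunE setU11 mulr0 add0r; congr (_ + _).
apply: eq_bigr => x /andP[_ xe].
by rewrite ffunE in_setU1 eq_sym (negPf xe) (negPf es).
Qed.

Lemma del_chain A e i c :
  c \in chains (Delta (e |: A)) i -> del e c \in chains (Delta A) i.
Proof.
move/chainsP => h; apply/chainsP => s; rewrite ffunE; case: ifPn => // es.
move=> /h[/faceP[sA cmp] ->]; split=> //; apply/faceP; split=> //.
apply/subsetP => x xs; have := subsetP sA x xs; rewrite in_setU1.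
by case/orP => // /eqP xe; rewrite -xe xs in es.
Qed.

Lemma lk_chain A e i c :
  c \in chains (Delta (e |: A)) i -> lk e c \in chains (Delta (link A e)) (i - 1).
Proof.
move/chainsP => h; apply/chainsP => s; rewrite ffunE; case: ifPn => // es.
rewrite mulf_eq0 signr_eq0 /= => /h[/faceP[sA cmp]].
rewrite cardsU1 es add1n => E; split; last by lia.
apply/faceP; split=> [|x y xs ys]; last by apply: cmp; rewrite in_setU1 ?xs ?ys orbT.
apply/subsetP => x xs; have xe : x != e by apply: contraNneq es => <-.
have := subsetP sA x; rewrite !inE xs orbT => /(_ isT); rewrite (negPf xe) /= => ->.
by have := cmp x e; rewrite !inE xs eqxx orbT (negPf xe); apply.
Qed.

Lemma cone_chain A e i c :
  c \in chains (Delta (link A e)) i -> cone e c \in chains (Delta (e |: A)) (i + 1).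
Proof.
move/chainsP => h; apply/chainsP => s; rewrite ffunE; case: ifPn => // es.
rewrite mulf_eq0 signr_eq0 /= => /h[/faceP[sA cmp] E]; split; last first.
  by move: (cardsD1 e s); rewrite es; lia.
apply/faceP; split=> [|x y xs ys].
  apply/subsetP => x xs; rewrite in_setU1; have [//|xe /=] := eqVneq x e.
  by have := subsetP sA x; rewrite !inE xe xs => /(_ isT)/andP[].
have Q z : z \in s -> z != e -> lt z e || lt e z.
  by move=> zs ze; have := subsetP sA z; rewrite !inE ze zs => /(_ isT)/andP[].
have [->|xe] := eqVneq x e; have [->|ye] := eqVneq y e; rewrite ?eqxx //.
- by have := Q y ys ye; rewrite orbC => ->; rewrite orbT.
- by have := Q x xs xe; rewrite orbC => /orP[]->; rewrite ?orbT.
by apply: cmp; rewrite !inE ?xe ?ye.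
Qed.

Lemma chains_sub A A' i c :
  A \subset A' -> c \in chains (Delta A) i -> c \in chains (Delta A') i.
Proof.
move=> AA' /chainsP h; apply/chainsP => s /h[/faceP[sA cmp] ->]; split=> //.
by apply/faceP; split=> //; apply: subset_trans AA'.
Qed.

Lemma avoidP A e i c s : e \notin A -> c \in chains (Delta A) i -> e \in s -> c s = 0.
Proof.
move=> eA /chainsP h es; apply/eqP/negPn/negP => /h[/faceP[/subsetP/(_ e es)]].
by rewrite (negPf eA).
Qed.

Lemma del_id A e i c : e \notin A -> c \in chains (Delta A) i -> del e c = c.
Proof.
move=> eA cA; apply/ffunP => s; rewrite ffunE; case: ifP => // es.
by rewrite (avoidP eA cA).
Qed.

Lemma lk_id A e i c : e \notin A -> c \in chains (Delta A) i -> lk e c = 0.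
Proof.
move=> eA cA; apply/ffunP => s; rewrite !ffunE; case: ifP => // es.
by rewrite (avoidP eA cA) ?setU11 ?mulr0.
Qed.

Lemma del_cone e c : del e (cone e c) = 0.
Proof. by apply/ffunP => s; rewrite !ffunE; case: ifP => // ->. Qed.

Lemma lk_cone A e i c : e \notin A -> c \in chains (Delta A) i -> lk e (cone e c) = c.
Proof.
move=> eA cA; apply/ffunP => s; rewrite !ffunE; case: ifPn => es.
  by rewrite (avoidP eA cA).
rewrite setU11 setU1K // (_ : [set y in e |: s | lt y e] = [set y in s | lt y e]).
  by rewrite signrMK.
by apply/setP => x; rewrite !inE; case: eqP => // ->; rewrite lt_irr !andbF.
Qed.

(** This follows by comparing the parts away from e in the equation
  bd (bd c) = 0. *)
Lemma lk_bd A e i c :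
  c \in chains (Delta (e |: A)) i -> lk e (bd c) = - bd (lk e c).
Proof.
move=> cA; have /eqP := del_bd e (bd c).
rewrite (bd_bd cA) del_bd raddfD /= (bd_bd (del_chain cA)) add0r.
rewrite (_ : del e 0 = 0); last by apply/ffunP => s; rewrite !ffunE if_same.
by rewrite eq_sym addrC addr_eq0 => /eqP.
Qed.

Section AddVertex.
Variables (S : {set T}) (e : T).
Hypothesis eS : e \notin S.

Lemma link_sub : link S e \subset S.
Proof. by apply/subsetP => x; rewrite inE => /andP[]. Qed.

Lemma notin_link : e \notin link S e.
Proof. by apply/negP => /(subsetP link_sub); rewrite (negPf eS). Qed.

Let incl i c : c \in chains (Delta S) i -> c \in chains (Delta (e |: S)) i.
Proof. exact: chains_sub (subsetUr _ _). Qed.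

(** The link part of a cycle z bounds some b in the link; adding the boundary
  of the cone over b to z removes that part and leaves a cycle of S. *)
Lemma exact_add_vertex i :
  exact_at S i -> exact_at (link S e) (i - 1) -> exact_at (e |: S) i.
Proof.
move=> exS exL z /cyclesP[zK zB].
have [|b] := exL (lk e z).
  apply/cyclesP; split; first exact: lk_chain.
  by apply: oppr_inj; rewrite -(lk_bd zK) zB (lk_id (i := i) eS) ?oppr0 ?rpred0.
rewrite subrK => bL Eb.
have dK := cone_chain bL; set d := cone e b in dK.
have lkd : lk e d = b by rewrite (lk_cone notin_link bL).
have z'0 : lk e (z + bd d) = 0 by rewrite lkD (lk_bd dK) lkd Eb subrr.
have z'K : z + bd d \in chains (Delta (e |: S)) i.
  rewrite rpredD //; suff /cyclesP[] : bd d \in cycles lt (Delta (e |: S)) i by [].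
  apply: boundary_cycle dK; first exact: order_complex_simplicial.
  exact: order_complex_oriented.
have z'B : bd (z + bd d) = 0 by rewrite raddfD /= zB (bd_bd dK) addr0.
have Ez' : del e (z + bd d) = z + bd d.
  have dS := del_chain z'K.
  apply: (@del_lk_inj e); first by rewrite (del_id eS dS).
  by rewrite (lk_id eS dS).
have [|b' b'S Eb'] := exS (z + bd d).
  by apply/cyclesP; split=> //; rewrite -Ez'; apply: del_chain.
exists (b' - d); first by rewrite rpredB // incl.
by rewrite raddfB /= -Eb' addrK.
Qed.

(** A cycle y of the link that bounds in S but not in the link gives a new cycle,
  made of a chain of S filling y and of the cone over y. If this bounded d, then
  y would bound the link part of d up to sign. *)
Lemma nonexact_new_vertex i :
  exact_at S (i - 1) -> ~ exact_at (link S e) (i - 1) -> ~ exact_at (e |: S) i.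
Proof.
move=> exS nexL exK; apply: nexL => y /cyclesP[yL yB].
have [|b bS Eb] := exS y.
  by apply/cyclesP; split=> //; apply: chains_sub link_sub _.
rewrite subrK in bS.
have nL := notin_link; have lky := lk_cone nL yL.
have yK := cone_chain yL; rewrite subrK in yK.
have [|d dK Ed] := exK (cone e y - b).
  apply/cyclesP; split; first by rewrite rpredB // incl.
  apply: (@del_lk_inj e).
    rewrite del_bd delD del_cone lkD lkN lky (lk_id eS bS) add0r subr0.
    apply/eqP; rewrite [X in _ == X](_ : _ = 0); last first.
      by apply/ffunP => s; rewrite !ffunE if_same.
    rewrite (_ : del e (- b) = - b); first by rewrite raddfN /= Eb addNr.
    by apply: (del_id (i := i) eS); rewrite rpredN.
  have wK : cone e y - b \in chains (Delta (e |: S)) i by rewrite rpredB // incl.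
  rewrite (lk_bd wK) lkD lky lkN (lk_id eS bS) subr0 yB oppr0.
  by rewrite (lk_id (i := i) eS) ?rpred0.
exists (- lk e d); first by rewrite rpredN subrK -[i](addrK 1) lk_chain.
have := congr1 (lk e) Ed; rewrite lkD lky lkN (lk_id eS bS) subr0 => ->.
by rewrite (lk_bd dK) raddfN.
Qed.

(** If a cycle of S bounds d after the addition of e, the link part of d is
  itself a cycle of the link; when the link is exact there, d can be corrected
  by the boundary of a cone so that it avoids e. *)
Lemma nonexact_old_vertex i :
  ~ exact_at S i -> exact_at (link S e) i -> ~ exact_at (e |: S) i.
Proof.
move=> nexS exL exK; apply: nexS => z /cyclesP[zS zB].
have [|d dK Ed] := exK z; first by apply/cyclesP; split=> //; apply: incl.
have dL := lk_chain dK; rewrite addrK in dL.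
have [|b bL Eb] := exL (lk e d).
  apply/cyclesP; split=> //.
  by apply: oppr_inj; rewrite -(lk_bd dK) -Ed (lk_id eS zS) oppr0.
have bK := cone_chain bL; set f := cone e b in bK.
have fB : bd f \in chains (Delta (e |: S)) (i + 1).
  suff /cyclesP[] : bd f \in cycles lt (Delta (e |: S)) (i + 1) by [].
  apply: boundary_cycle bK; first exact: order_complex_simplicial.
  exact: order_complex_oriented.
have d'K : d + bd f \in chains (Delta (e |: S)) (i + 1) by rewrite rpredD.
have dS := del_chain d'K.
exists (del e (d + bd f)) => //.
have -> : del e (d + bd f) = d + bd f.
  apply: (@del_lk_inj e); first by rewrite (del_id eS dS).
  by rewrite (lk_id eS dS) lkD (lk_bd bK) (lk_cone notin_link bL) Eb subrr.
by rewrite raddfD /= (bd_bd bK) addr0.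
Qed.

End AddVertex.

(** Every cycle bounds the cone with apex e over its part away from e. *)
Lemma exact_cone A e i :
  e \in A -> {in A, forall x, [|| x == e, lt x e | lt e x]} -> exact_at A i.
Proof.
move=> eA cmp; rewrite -(setD1K eA); set S := A :\ e.
have eS : e \notin S by rewrite !inE eqxx.
have ES : link S e = S.
  apply/setP => x; rewrite !inE; have [//|/= xe] := eqVneq x e.
  by case xA: (x \in A) => //=; have := cmp _ xA; rewrite (negPf xe).
move=> z /cyclesP[zK zB].
have dS := del_chain zK.
have cK : cone e (del e z) \in chains (Delta (e |: S)) (i + 1).
  by apply: cone_chain; rewrite ES.
exists (cone e (del e z)) => //.
have lkc := lk_cone eS dS.
apply: (@del_lk_inj e).
  by rewrite del_bd del_cone raddf0 add0r lkc.
rewrite (lk_bd cK) lkc; apply/eqP; rewrite -addr_eq0 addrC -del_bd zB.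
by apply/eqP/ffunP => s; rewrite !ffunE if_same.
Qed.

Lemma exact_set0 i : i != -1 -> exact_at set0 i.
Proof.
move=> ni z /cyclesP[/chainsP zK _]; exists 0; first exact: rpred0.
rewrite raddf0; apply/ffunP => s; rewrite [RHS]ffunE.
apply/eqP/negPn/negP => /zK[/faceP[]]; rewrite subset0 => /eqP-> _.
by rewrite cards0; move/eqP: ni; lia.
Qed.

Lemma nonexact_set0 : ~ exact_at set0 (-1).
Proof.
pose z : {ffun {set T} -> int} := [ffun s => if s == set0 then 1 else 0].
move=> /(_ z)[|b /chainsP bK Eb].
  apply/cyclesP; split.
    apply/chainsP => s; rewrite ffunE.
    have [-> _|_] := eqVneq s set0; last by rewrite eqxx.
    by rewrite cards0; split=> //; apply/faceP; split=> [|x y]; rewrite ?sub0set ?inE.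
  apply/ffunP => s; rewrite !ffunE big1 // => x _.
  by rewrite ffunE; case: eqP => [/setP/(_ x)|_]; rewrite ?mulr0 // !inE eqxx.
suff b0 : b = 0.
  by move/ffunP/(_ set0): Eb; rewrite b0 raddf0 !ffunE eqxx.
apply/ffunP => s; rewrite [RHS]ffunE.
apply/eqP/negPn/negP => /bK[/faceP[]]; rewrite subset0 => /eqP-> _.
by rewrite cards0.
Qed.

(** When the elements of N are added to S with larger ones first, the elements
  of N present when e is added and comparable with e are those above e. *)
Definition stage_link S N e :=
  [set s in S :|: N | lt e s || (s \in S) && lt s e].

(** The induction adds the elements of N with larger ones first: the subsets M
  of N that are reached are the up-closed ones, and the last element added is
  minimal in M, which determines its link. *)
Lemma extend_ind S N (Q : {set T} -> Prop) :
    [disjoint S & N] -> Q S ->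
    (forall e A, e \in N -> e \notin A -> S \subset A -> A \subset S :|: N ->
       link A e = stage_link S N e -> Q A -> Q (e |: A)) ->
  Q (S :|: N).
Proof.
move=> dSN QS Qadd.
suff main n (M : {set T}) : #|M| = n -> M \subset N ->
    (forall x y, x \in M -> y \in N -> lt x y -> y \in M) -> Q (S :|: M).
  by apply: (main #|N| N).
elim: n M => [|n IH] M cM MN up.
  by move/eqP: cM; rewrite cards_eq0 => /eqP->; rewrite setU0.
have /card_gt0P[e0 e0M] : (0 < #|M|)%N by rewrite cM.
(* a minimal element of M has the fewest elements of M below it *)
case: (arg_minnP (fun e => #|[set y in M | lt y e]|) e0M) => e eM emin.
have minE x : x \in M -> ~~ lt x e.
  move=> xM; apply/negP => xe; have := emin x xM; rewrite leqNgt => /negP[].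
  apply: proper_card; apply/properP; split.
    apply/subsetP => y; rewrite !inE => /andP[-> yx] /=; exact: lt_trans xe.
  by exists x; rewrite !inE xM ?xe ?lt_irr.
rewrite -(setD1K eM) setUCA; set A := S :|: _.
have eN := subsetP MN e eM.
have eS : e \notin S.
  by apply/negP => eS; move/disjoint_setI0/setP/(_ e): dSN; rewrite !inE eS eN.
apply: Qadd => //.
- by rewrite !inE eqxx /= (negPf eS).
- exact: subsetUl.
- by apply: setUS; apply: subset_trans MN; apply: subD1set.
- apply/setP => x; rewrite !inE.
  have [xS|xS] /= := boolP (x \in S); first by rewrite orbC.
  rewrite orbF; have [->|/= xe] := eqVneq x e; first by rewrite lt_irr !andbF.
  apply/andP/andP => -[].
    by move=> xM; rewrite (negPf (minE x xM)) (subsetP MN).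
  by move=> xN ex; rewrite ex orbT (up e x).
apply: IH; first by move: cM; rewrite (cardsD1 e) [e \in M]eM => -[].
  by apply: subset_trans MN; apply: subD1set.
move=> x y; rewrite !inE => /andP[xe xM] yN xy; rewrite (up x y) // andbT.
by apply: contraTneq xy => ->; apply: minE.
Qed.

Lemma exact_extend S N i :
    [disjoint S & N] -> exact_at S i ->
    {in N, forall e, exact_at (stage_link S N e) (i - 1)} ->
  exact_at (S :|: N) i.
Proof.
move=> dSN exS exL.
apply: (@extend_ind S N (fun A => exact_at A i)) => // e A eN eA _ _ EL QA.
by apply: (exact_add_vertex eA QA); rewrite EL; apply: exL.
Qed.

Lemma nonexact_extend_old S N i :
    [disjoint S & N] -> ~ exact_at S i ->
    {in N, forall e, exact_at (stage_link S N e) i} ->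
  ~ exact_at (S :|: N) i.
Proof.
move=> dSN exS exL.
apply: (@extend_ind S N (fun A => ~ exact_at A i)) => // e A eN eA _ _ EL QA.
by apply: (nonexact_old_vertex eA QA); rewrite EL; apply: exL.
Qed.

(** Before e0 is added the complex may or may not have acquired homology in
  degree i from other elements of N; what is preserved is that it has acquired
  some, or that e0 is missing and degree i - 1 is still exact. *)
Lemma nonexact_extend_new S N e0 i :
    [disjoint S & N] -> exact_at S (i - 1) ->
    e0 \in N -> ~ exact_at (stage_link S N e0) (i - 1) ->
    {in N, forall e, exact_at (stage_link S N e) i} ->
    {in N, forall e, exact_at (stage_link S N e) (i - 1 - 1)} ->
  ~ exact_at (S :|: N) i.
Proof.
move=> dSN exS e0N nexL exL exL2.
pose Q A := e0 \notin A /\ exact_at A (i - 1) \/ ~ exact_at A i.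
suff : Q (S :|: N) by case=> // -[]; rewrite inE e0N orbT.
apply: extend_ind => // [|e A eN eA _ _ EL].
  left; split=> //; apply/negP => e0S.
  by move/disjoint_setI0/setP/(_ e0): dSN; rewrite !inE e0S e0N.
case=> [[e0A exA]|nexA]; last first.
  by right; apply: (nonexact_old_vertex eA nexA); rewrite EL; apply: exL.
have [exe|nexe] := pselect (exact_at (stage_link S N e) (i - 1)); last first.
  by right; apply: (nonexact_new_vertex eA exA); rewrite EL.
left; split; last by apply: (exact_add_vertex eA exA); rewrite EL; apply: exL2.
by rewrite !inE negb_or e0A andbT; apply: contra_notN nexL => /eqP->.
Qed.

(** A poset with x <= f x >= s0 is contractible. Here this is obtained by
  starting with the cone of the elements above s0. The link of any other x at
  the time of its addition is the set of elements above x, to which f restricts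
  with f x in the place of s0. *)
Lemma exact_conical (f : T -> T) S (s0 : T) i :
    s0 \in S ->
    {in S, forall x, f x \in S} ->
    {in S &, forall x y, lt x y -> f x = f y \/ lt (f x) (f y)} ->
    {in S, forall x, x = f x \/ lt x (f x)} ->
    {in S, forall x, s0 = f x \/ lt s0 (f x)} ->
  exact_at S i.
Proof.
move: {2}_.+1 (ltnSn #|S|) => n; elim: n => // n IH in S s0 i *.
rewrite ltnS => cS s0S fS fmono fge fge0.
pose S0 := [set x in S | (x == s0) || lt s0 x].
have ES : S = S0 :|: S :\: S0.
  by rewrite setDE setUIr setUCr setIT; apply/esym/setUidPr/subsetP => x /setIdP[].
rewrite ES; apply: exact_extend.
- by rewrite -setI_eq0 setDE setICA setICr setI0.
- apply: (@exact_cone _ s0); first by rewrite !inE s0S eqxx.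
  by move=> x; rewrite inE => /andP[_ /orP[]->]; rewrite ?orbT.
move=> x; rewrite !inE => /andP[x0 xS].
have Elink : stage_link S0 (S :\: S0) x = [set y in S | lt x y].
  rewrite /stage_link -ES; apply/setP => y; rewrite !inE.
  have [yS|//] := boolP (y \in S); rewrite /=.
  have [//|xy] /= := boolP (lt x y); apply/negbTE/negP => /andP[s0y yx].
  case/negP: x0; rewrite xS /=; case/orP: s0y => [/eqP <-|s0y]; rewrite ?yx ?orbT //.
  by rewrite (lt_trans s0y) ?orbT.
have xfx : lt x (f x).
  case: (fge x xS) => // Ex; case/negP: x0; rewrite xS /= {1}Ex {2}Ex.
  by case: (fge0 x xS) => [->|->]; rewrite ?eqxx ?orbT.
rewrite Elink; apply: (IH _ (f x)).
- apply: leq_trans cS; apply: proper_card; apply/properP; split.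
    by apply/subsetP => y /setIdP[].
  by exists x; rewrite // inE lt_irr andbF.
- by rewrite inE fS.
- move=> y /setIdP[yS xy]; rewrite inE fS //=.
  by case: (fge y yS) => [<-//|]; apply: lt_trans.
- by move=> y z /setIdP[yS _] /setIdP[zS _]; apply: fmono.
- by move=> y /setIdP[yS _]; apply: fge.
by move=> y /setIdP[yS xy]; apply: fmono.
Qed.

End PosetHomology.

(** * Isotropic subspaces of a symplectic space, as abelian subgroups *)

Section AbelianSubgroups.
Local Open Scope group_scope.
Variables (gT : finGroupType) (p : nat).
Hypothesis p_pr : prime p.
Implicit Types A B C F G R U V Z : {group gT}.
Implicit Types x y : gT.

Local Notation lt := (@group_proper gT).
Local Notation exact_at := (exact_at lt).
Local Notation stage_link := (stage_link lt).

Lemma gprop_irr : irreflexive lt.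
Proof. by move=> F; apply: properxx. Qed.

Lemma gprop_trans : transitive lt.
Proof. by move=> F E G; apply: proper_trans. Qed.

Lemma sub_eq_or_proper A B : A \subset B -> A = B \/ lt A B.
Proof.
by rewrite subEproper => /orP[/eqP AB|]; [left; apply: val_inj | right].
Qed.

Lemma index_prime_sandwich A B C :
  A \subset B -> B \subset C -> prime #|C : A| -> B != C -> B = A :> {group gT}.
Proof.
move=> AB BC prAC nBC.
have /maxgroupP[_] := p_index_maximal (subset_trans AB BC) prAC.
by move=> max; apply/val_inj/max; rewrite // properEneq BC nBC.
Qed.

Lemma index_join_cycle Z x :
  x \notin Z -> x ^+ p = 1 -> Z \subset 'C[x] -> #|Z <*> <[x]> : Z| = p.
Proof.
move=> xZ xp Zx; have ox : #[x] = p.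
  by apply: nt_prime_order => //; apply: contraNneq xZ => ->.
have cxZ : <[x]> \subset 'C(Z) by rewrite cycle_subG -sub_cent1.
rewrite (cent_joinEr cxZ) indexMg -indexgI prime_TIg ?indexg1 //.
  by rewrite -orderE ox.
by rewrite cycle_subG.
Qed.

Lemma abelem_join A B :
  p.-abelem A -> p.-abelem B -> B \subset 'C(A) -> p.-abelem (A <*> B).
Proof.
move=> abA abB cAB; have EAB : A \* B = A <*> B by rewrite cprodE // cent_joinEr.
by rewrite (cprod_abelem p EAB) abA.
Qed.

Lemma abelem_cycle x : x ^+ p = 1 -> p.-abelem <[x]>.
Proof.
move=> xp; apply/abelemP => //; split; first exact: cycle_abelian.
by move=> _ /cycleP[i ->]; rewrite -expgM mulnC expgM xp expg1n.
Qed.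

Definition above R U : {set {group gT}} := [set F in 'E_p(U) | R \proper F].

Lemma aboveP R U F :
  reflect [/\ F \subset U, p.-abelem F & R \proper F] (F \in above R U).
Proof.
rewrite inE; apply: (iffP andP) => [[/pElemP[? ?] ?]|[? ? ?]] //.
by split=> //; apply/pElemP.
Qed.

(** The contraction F <= F <*> B >= R <*> B. *)
Lemma exact_join_conical (S : {set {group gT}}) R B i :
    {in S, forall F, R \subset F} ->
    (R <*> B)%G \in S -> {in S, forall F, (F <*> B)%G \in S} ->
  exact_at S i.
Proof.
move=> RS s0S fS.
pose f F := (F <*> B)%G.
apply: (@exact_conical _ _ gprop_irr gprop_trans f S (R <*> B)%G i) => //.
- move=> F G _ _ ltFG; apply: sub_eq_or_proper.
  by rewrite genS // setSU // proper_sub.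
- by move=> F _; apply: sub_eq_or_proper; apply: joing_subl.
by move=> F FS; apply: sub_eq_or_proper; rewrite genS // setSU // RS.
Qed.

Section Class2.
Variable Z : {group gT}.
Hypothesis oZ : #|Z| = p.

(** With #|Z| = p, the commutator induces an alternating F_p-valued form on
  U / 'Z(U), and the subgroups between 'Z(U) and U that are abelian correspond
  to the isotropic subspaces; they are automatically elementary abelian. *)
Definition class2_over U : Prop :=
  [/\ {in U, forall x, x ^+ p = 1}, U^`(1) \subset Z & Z \subset 'Z(U)].

Lemma class2_abelem U F : class2_over U -> F \subset U -> abelian F -> p.-abelem F.
Proof.
by move=> [expU _ _] FU cF; apply/abelemP => //; split=> // x /(subsetP FU)/expU.
Qed.

(** The conjugates of x lie in the coset x *: Z. *)
Lemma class2_index U G x :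
  class2_over U -> G \subset U -> x \in U -> (#|G : 'C_G[x]| <= p)%N.
Proof.
move=> [_ dU _] GU xU; rewrite index_cent1 -oZ -(card_lcoset Z x).
apply: subset_leq_card; apply/subsetP => _ /imsetP[g gG ->].
rewrite mem_lcoset; apply: (subsetP dU); rewrite derg1.
by rewrite -[x^-1 * _]/([~ x, g]) mem_commg // (subsetP GU).
Qed.

Lemma class2_pgroup U G : class2_over U -> G \subset U -> p.-group G.
Proof.
move=> [expU _ _] GU; apply/pgroupP => q q_pr /(Cauchy q_pr)[x xG oxq].
have : (#[x] %| p)%N by rewrite order_dvdn expU ?(subsetP GU).
by rewrite oxq (dvdn_prime2 q_pr p_pr) inE.
Qed.

Lemma class2_index_eq U G x :
    class2_over U -> G \subset U -> x \in U -> ~~ (G \subset 'C[x]) ->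
  #|G : 'C_G[x]| = p.
Proof.
move=> cU GU xU nGx; have pG := class2_pgroup cU GU.
have [[|[|k]] E] := p_natP (pnat_dvd (dvdn_indexg G 'C_G[x]) pG).
- by move/eqP: E; rewrite indexg_eq1 subsetI (negPf nGx) andbF.
- by rewrite E expn1.
have := class2_index cU GU xU; rewrite E leqNgt.
by rewrite -{1}(expn1 p) (ltn_exp2l _ _ (prime_gt1 p_pr)).
Qed.

Lemma class2_sub U V :
  class2_over U -> V \subset U -> Z \subset V -> class2_over V.
Proof.
move=> [expU dU ZU] VU ZV; split=> [x /(subsetP VU)/expU //||].
  exact: subset_trans (dergS 1 VU) dU.
by rewrite subsetI ZV (subset_trans _ (centS VU)) // (subset_trans ZU) ?subsetIr.
Qed.

(** Symplectic reduction: when F / R is a line that is not orthogonal to x, the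
  group 'C_U(F) has centre F and 'C_U(F) / F is a symplectic space of dimension
  two less than that of U / R. *)
Section Reduction.
Variables (U R F : {group gT}) (x : gT) (n : nat).
Hypotheses (cU : class2_over U) (ZU : 'Z(U) = R).
Hypothesis cardU : #|U : R| = (p ^ (2 * n.+1))%N.
Hypotheses (xU : x \in U) (Fab : F \in above R U) (xF : 'C_F[x] = R).

Let FU : F \subset U. Proof. by case/aboveP: Fab. Qed.
Let abF : abelian F. Proof. by case/aboveP: Fab => _ /abelem_abelian. Qed.
Let RF : R \proper F. Proof. by case/aboveP: Fab. Qed.
Let RU : R \subset U. Proof. by rewrite -ZU subsetIl. Qed.
Let cRU : R \subset 'C(U). Proof. by rewrite -ZU subsetIr. Qed.

Let iFR : #|F : R| = p.
Proof.
rewrite -xF (class2_index_eq cU) //; apply/negP => Fx.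
by move: RF; rewrite -xF (setIidPl Fx) properxx.
Qed.

Lemma reduction_cent1 : exists2 y, y \in F :\: R & 'C_U(F) = 'C_U[y].
Proof.
have [_ [y yF yR]] := properP RF.
exists y; first by rewrite inE yR.
have EF : (R <*> <[y]>)%G = F.
  apply/eqP; apply: contraTT yR => nE; rewrite negbK.
  have E : (R <*> <[y]>)%G = R.
    apply: (index_prime_sandwich _ _ _ nE); rewrite ?joing_subl ?iFR //.
    by rewrite join_subG proper_sub //= cycle_subG.
  by rewrite -E /= -cycle_subG joing_subr.
apply/eqP; rewrite eqEsubset; apply/andP; split.
  by rewrite setIS // -cent_set1 centS ?sub1set.
rewrite subsetI subsetIl /= centsC -EF join_subG; apply/andP; split.
  exact: subset_trans cRU (centS (subsetIl _ _)).
by rewrite cycle_subG -sub_cent1 subsetIr.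
Qed.

Lemma reduction_class2 : class2_over 'C_U(F).
Proof.
case: (cU) => _ _; rewrite ZU => ZR.
apply: class2_sub cU (subsetIl _ _) _; rewrite subsetI (subset_trans ZR RU) /=.
by apply: subset_trans ZR (subset_trans cRU (centS FU)).
Qed.

Lemma reduction_center : 'Z('C_U(F)) = F.
Proof.
have FC : F \subset 'C_U(F) by rewrite subsetI FU.
have [y /setDP[yF yR] EC] := reduction_cent1.
set W : {group gT} := 'Z('C_U(F))%G; rewrite -[LHS]/(gval W).
have WU : W \subset U by apply: subset_trans (subsetIl _ _) (subsetIl _ _).
have FW : F \subset W by rewrite subsetI FC centsC subsetIr.
have xy : x \notin 'C[y].
  rewrite cent1C; apply: contra yR => yx.
  by rewrite -xF inE yF.
have yU := subsetP FU y yF.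
have iUC : #|U : 'C_U[y]| = p.
  by apply: (class2_index_eq cU) => //; apply: contra xy => /subsetP->.
(* An element of W centralizes 'C_U(F), which is maximal in U and does not
   contain x. If it commutes with x as well, it is central in U. *)
have WxR : 'C_W[x] = R.
  apply/eqP; rewrite eqEsubset; apply/andP; split; last first.
    rewrite subsetI (subset_trans (proper_sub RF) FW) sub_cent1.
    by rewrite (subsetP _ _ xU) // centsC.
  apply/subsetP => w /setIP[wW wx]; rewrite -ZU inE (subsetP WU) //= -sub_cent1.
  apply/setIidPl/eqP; apply: contraNT xy => nE.
  have EC1 : ('C_U[w])%G = ('C_U[y])%G.
    apply: (@index_prime_sandwich _ _ U); rewrite ?subsetIl ?iUC //.
    rewrite subsetI subsetIl /= -EC sub_cent1.
    by case/setIP: wW.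
  have := congr1 (fun G : {group gT} => x \in G) EC1.
  by rewrite /= in_setI xU cent1C wx in_setI xU /= => <-.
have iWR : #|W : R| = p.
  rewrite -WxR (class2_index_eq cU) //; apply: contraL RF => Wx.
  rewrite -WxR (setIidPl Wx); apply/negP => /proper_sub_trans/(_ FW).
  by rewrite properxx.
apply/eqP; rewrite eqEsubset FW andbT -indexg_eq1.
rewrite -(@eqn_pmul2r #|F : R|) ?indexg_gt0 // Lagrange_index ?(proper_sub RF) //.
by rewrite iWR iFR mul1n.
Qed.

Lemma reduction_index : #|'C_U(F) : F| = (p ^ (2 * n))%N.
Proof.
have [y /setDP[yF yR] EC] := reduction_cent1.
have iUC : #|U : 'C_U(F)| = p.
  rewrite EC; apply: (class2_index_eq cU) => //; first exact: (subsetP FU).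
  apply: contra yR => Uy; rewrite -ZU inE (subsetP FU) //=.
  by rewrite -sub_cent1.
have FC : F \subset 'C_U(F) by rewrite subsetI FU.
apply/eqP; rewrite -(@eqn_pmul2l (p * p)) ?muln_gt0 ?prime_gt0 //.
rewrite -{1}iUC -{1}iFR -mulnA [(_ * #|_ : F|)%N]mulnC mulnA.
rewrite Lagrange_index ?subsetIl // Lagrange_index ?(proper_sub RF) //.
by rewrite cardU mulnS expnD -mulnn.
Qed.

End Reduction.

Lemma card_gt_index U R n : #|U : R| = (p ^ (2 * n.+1))%N -> ~~ (U \subset R).
Proof.
move=> E; rewrite -indexg_eq1 E -[X in _ != X](expn0 p) eqn_exp2l ?prime_gt1 //.
Qed.

(** The argument of the Solomon-Tits theorem, by induction on the dimension 2n.
  For x outside the centre, the isotropic subspaces F orthogonal to x contract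
  by F <= F + <x> >= <x>. The link of any other F is a cone, with apex the
  orthogonal of x in F, unless this orthogonal vanishes. In that case F is a
  line, and its link is the same poset for the symplectic reduction at F, with
  homology in degree n - 2 (for 2n the dimension before reduction) only. *)
Theorem symplectic_homology n U R :
    class2_over U -> 'Z(U) = R -> #|U : R| = (p ^ (2 * n))%N ->
  (forall i : int, i != (n%:Z - 1)%R -> exact_at (above R U) i) /\
  ~ exact_at (above R U) (n%:Z - 1)%R.
Proof.
elim: n U R => [|n IH] U R cU ZU cardU.
  have -> : above R U = set0.
    apply/setP => F; rewrite inE [RHS]inE; apply/negP => /andP[/pElemP[FU _]].
    move/eqP: cardU; rewrite indexg_eq1 => UR /proper_sub_trans/(_ FU).
    by move/proper_sub_trans/(_ UR); rewrite properxx.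
  split; last exact: nonexact_set0.
  by move=> i; apply: exact_set0.
have [x xU xR] : exists2 x, x \in U & x \notin R.
  exact/subsetPn/(card_gt_index cardU).
have RU : R \subset U by rewrite -ZU subsetIl.
have cRU : R \subset 'C(U) by rewrite -ZU subsetIr.
have xp : x ^+ p = 1 by case: cU => /(_ x xU).
have abR : p.-abelem R.
  by apply: class2_abelem cU RU _; rewrite -ZU center_abelian.
have Rx : R \subset 'C[x].
  by apply: subset_trans cRU _; rewrite -cent_set1 centS ?sub1set.
pose S := [set F in above R U | F \subset 'C[x]].
pose N := above R U :\: S.
have [TSN dSN] : above R U = S :|: N /\ [disjoint S & N].
  by apply: split_subset; apply/subsetP => F /setIdP[].
have SP F :
    reflect [/\ F \subset U, p.-abelem F, R \proper F & F \subset 'C[x]] (F \in S).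
  apply: (iffP setIdP) => [[/aboveP[? ? ?] ?]|[? ? ? ?]] //.
  by split=> //; apply/aboveP.
have NP F : F \in N ->
    [/\ F \subset U, p.-abelem F, R \proper F & ~~ (F \subset 'C[x])].
  case/setDP=> FT; rewrite inE FT /= => nFx; case/aboveP: FT => FU Fab RF; by split.
have exS i : exact_at S i.
  apply: (@exact_join_conical S R <[x]>%G) => [F||F].
  - by case/SP=> _ _ /proper_sub.
  - apply/SP; split.
    + by rewrite join_subG RU cycle_subG.
    + by apply: abelem_join; rewrite ?abelem_cycle // cycle_subG -sub_cent1.
    + apply/properP; split; first exact: joing_subl.
      by exists x => //; rewrite -cycle_subG joing_subr.
    by rewrite join_subG Rx cycle_subG cent1id.
  case/SP=> FU abF RF Fx; apply/SP; split.
  - by rewrite join_subG FU cycle_subG.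
  - by apply: abelem_join; rewrite ?abelem_cycle // cycle_subG -sub_cent1.
  - exact: proper_sub_trans RF (joing_subl _ _).
  by rewrite join_subG Fx cycle_subG cent1id.
have linkN F : F \in N -> 'C_F[x] = R -> stage_link S N F = above F 'C_U(F).
  case/NP=> FU abF RF nFx CFx; apply/setP => G; rewrite inE -TSN.
  apply/andP/aboveP => [[/aboveP[GU abG RG]]|[]].
    case/orP=> [FG|/andP[/SP[_ _ _ Gx] GF]]; last first.
      have := proper_sub_trans RG (_ : G \subset 'C_F[x]).
      by rewrite subsetI (proper_sub GF) Gx CFx properxx => /(_ isT).
    split=> //; rewrite subsetI GU centsC.
    exact: subset_trans (proper_sub FG) (abelem_abelian abG).
  rewrite subsetI => /andP[GU _] abG FG; split; last by apply/orP; left.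
  by apply/aboveP; split=> //; apply: proper_trans FG.
have linkC F i : F \in N -> 'C_F[x] != R -> exact_at (stage_link S N F) i.
  move=> FN nCF; have [FU abF RF nFx] := NP F FN.
  have RC : R \subset 'C_F[x] by rewrite subsetI (proper_sub RF).
  have MF : 'C_F[x] \proper F.
    by rewrite properEneq subsetIl andbT; apply: contraNneq nFx => <-; apply: subsetIr.
  have MS : ('C_F[x])%G \in S.
    apply/SP; split; last exact: subsetIr.
    - exact: subset_trans (subsetIl _ _) FU.
    - by apply: abelemS abF; apply: subsetIl.
    by rewrite properEneq eq_sym nCF.
  apply: (@exact_cone _ _ gprop_irr gprop_trans _ ('C_F[x])%G).
    by rewrite inE in_setU MS; apply/orP; right; apply: MF.
  move=> G; rewrite inE => /andP[_] /orP[FG|/andP[/SP[_ _ _ Gx] GF]].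
    by apply/or3P; apply: Or33; apply: proper_trans FG.
  have : G \subset ('C_F[x])%G by rewrite subsetI (proper_sub GF).
  by case/sub_eq_or_proper=> [->|->]; rewrite ?eqxx ?orbT.
have linkR F : F \in N -> 'C_F[x] = R ->
    (forall i : int, i != (n%:Z - 1)%R -> exact_at (stage_link S N F) i) /\
    ~ exact_at (stage_link S N F) (n%:Z - 1)%R.
  move=> FN CF; rewrite linkN //; have [FU abF RF nFx] := NP F FN.
  have FT : F \in above R U by apply/aboveP.
  apply: (IH ('C_U(F))%G).
  - exact: (reduction_class2 cU ZU FT).
  - exact: (reduction_center cU ZU xU FT CF).
  exact: (reduction_index cU ZU cardU xU FT CF).
have linkE F i : F \in N -> i != (n%:Z - 1)%R -> exact_at (stage_link S N F) i.
  move=> FN ni; have [CF|nCF] := eqVneq 'C_F[x] (R : {set gT}); last exact: linkC.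
  by case: (linkR F FN CF) => H _; apply: H.
have E1 : (n.+1%:Z - 1 = n)%R by lia.
rewrite E1 TSN; split=> [i ni|].
  apply: (exact_extend gprop_irr gprop_trans dSN (exS i)) => F FN.
  by apply: linkE => //; move: ni; lia.
have [y yU nyx] : exists2 y, y \in U & y \notin 'C[x].
  apply/subsetPn; apply: contra xR => Ux.
  by rewrite -ZU inE xU -sub_cent1.
have yR : y \notin R by apply: contra nyx; apply: (subsetP Rx).
have yp : y ^+ p = 1 by case: cU => /(_ y yU).
have Ry : R \subset 'C[y].
  by apply: subset_trans cRU _; rewrite -cent_set1 centS ?sub1set.
pose F0 := (R <*> <[y]>)%G.
have yF : y \in F0 by rewrite -cycle_subG joing_subr.
have F0N : F0 \in N.
  rewrite inE andbC; apply/andP; split.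
    apply/aboveP; split.
    - by rewrite join_subG RU cycle_subG.
    - by apply: abelem_join; rewrite ?abelem_cycle // cycle_subG -sub_cent1.
    by apply/properP; split; [apply: joing_subl | exists y].
  by apply/SP => -[_ _ _ /subsetP/(_ y yF)]; rewrite (negPf nyx).
have CF0 : 'C_F0[x] = R.
  have iF0 : #|F0 : R| = p by apply: index_join_cycle.
  suff E : ('C_F0[x])%G = R by exact: (congr1 (@gval gT) E).
  apply: (index_prime_sandwich (_ : R \subset _) (subsetIl _ _)); rewrite ?iF0 //.
    by rewrite subsetI joing_subl.
  by apply: contraNneq nyx => E; have : y \in ('C_F0[x])%G; [rewrite E | case/setIP].
apply: (nonexact_extend_new gprop_irr gprop_trans dSN (exS _) F0N).
- by case: (linkR F0 F0N CF0).
- by move=> F FN; apply: (linkE _ _ FN); rewrite -subr_eq0 subKr.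
by move=> F FN; apply: (linkE _ _ FN); rewrite -subr_eq0 addrAC subrr sub0r.
Qed.
End Class2.
End AbelianSubgroups.

(** * Attaching the elementary abelian subgroups outside Y *)

Section Attachment.
Local Open Scope group_scope.
Variables (gT : finGroupType) (p : nat).
Hypothesis p_pr : prime p.
Variables (P Y Z A : {group gT}) (t n : nat) (x0 : gT).
Implicit Types F G : {group gT}.
Implicit Type x : gT.
Hypotheses (oZ : #|Z| = p) (ZP : Z \subset 'Z(P)).
Hypotheses (nYP : Y <| P) (iPY : #|P : Y| = p).
Hypotheses (cY : class2_over p Z Y) (ZY : 'Z(Y) = Z).
Hypothesis (iYZ : #|Y : Z| = (p ^ (2 * n))%N).
Hypotheses (AY : A \subset Y) (cA : abelian A) (ZA : Z \proper A).
Hypothesis centA : {in P :\: Y, forall x, A \subset 'C('C_Y[x])}.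
Hypothesis centx : {in P :\: Y, forall x, x ^+ p = 1 -> ~~ (A \subset 'C[x]) ->
  'Z('C_Y[x]) = Z /\ #|'C_Y[x] : Z| = (p ^ (2 * t))%N}.
Hypotheses (x0P : x0 \in P :\: Y) (x0p : x0 ^+ p = 1).
Hypothesis (x0A : ~~ (A \subset 'C[x0])).

Local Notation lt := (@group_proper gT).
Local Notation exact_at := (exact_at lt).
Local Notation stage_link := (stage_link lt).
Local Notation above := (@above gT p).

Let ZsY : Z \subset Y. Proof. by rewrite -ZY subsetIl. Qed.
Let YP : Y \subset P. Proof. exact: normal_sub. Qed.
Let expY x : x \in Y -> x ^+ p = 1. Proof. by case: cY => /(_ x). Qed.
Let cZ x : x \in P -> Z \subset 'C[x].
Proof.
move=> xP; apply: subset_trans ZP _; rewrite subIset // -cent_set1.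
by rewrite centS ?sub1set ?orbT.
Qed.

Let abA : p.-abelem A.
Proof. exact: (class2_abelem p_pr cY AY). Qed.

Let abZ : p.-abelem Z.
Proof. exact: abelemS (proper_sub ZA) abA. Qed.

Let index_cap G : G \subset P -> ~~ (G \subset Y) -> #|G : G :&: Y| = p.
Proof.
move=> GP nGY; rewrite indexgI -indexMg -iPY -norm_joinEr; last first.
  exact: subset_trans GP (normal_norm nYP).
have nY : P != Y.
  by apply: contraNneq nGY => <-.
suff /(congr1 (@gval gT))/= -> : (Y <*> G)%G = P by [].
apply/eqP; apply: contraNT nGY => nE.
have E : (Y <*> G)%G = Y.
  apply: (index_prime_sandwich _ _ _ nE); rewrite ?joing_subl ?iPY //.
  by rewrite join_subG YP.
by rewrite -E joing_subr.
Qed.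

Let cent1_dprod x : x \in P -> x \notin Y -> x ^+ p = 1 ->
  'C_Y[x] \x <[x]> = 'C_P[x].
Proof.
move=> xP xY xp.
have cx : <[x]> \subset 'C('C_Y[x]) by rewrite cycle_subG -sub_cent1 subsetIr.
have ox : #[x] = p by apply: nt_prime_order => //; apply: contraNneq xY => ->.
have tix : 'C_Y[x] :&: <[x]> = 1.
  rewrite setIC prime_TIg -?orderE ?ox // cycle_subG; apply: contra xY.
  by case/setIP.
rewrite dprodE // -cent_joinEr //.
suff E : ('C_Y[x] <*> <[x]>)%G = ('C_P[x])%G by exact: (congr1 (@gval gT) E).
have xC : x \in 'C_P[x] by rewrite inE xP cent1id.
have EY : 'C_P[x] :&: Y = 'C_Y[x] by rewrite setIAC (setIidPr YP).
have iC : #|'C_P[x] : 'C_Y[x]| = p.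
  rewrite -EY; apply: index_cap; first exact: subsetIl.
  by apply/subsetPn; exists x.
apply/eqP; apply: contraT => nE.
have E : ('C_Y[x] <*> <[x]>)%G = ('C_Y[x])%G.
  apply: (index_prime_sandwich _ _ _ nE); rewrite ?joing_subl ?iC //.
  by rewrite join_subG setSI // cycle_subG.
have : x \in ('C_Y[x])%G by rewrite -E -cycle_subG joing_subr.
by case/setIP=> xY'; rewrite xY' in xY.
Qed.

Section Link.
Variable x : gT.
Hypotheses (xP : x \in P) (xY : x \notin Y) (xp : x ^+ p = 1).
Let xPY : x \in P :\: Y. Proof. by rewrite inE xY. Qed.

Lemma cap_join : ((Z <*> <[x]>) :&: Y)%G = Z.
Proof.
apply: (@index_prime_sandwich _ _ _ (Z <*> <[x]>)%G); rewrite ?subsetIl //.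
- by rewrite subsetI joing_subl.
- by rewrite (index_join_cycle p_pr) ?cZ //; apply: contra xY; apply: (subsetP ZsY).
apply: contraNneq xY => E.
have : x \in (Z <*> <[x]>)%G by rewrite -cycle_subG joing_subr.
by rewrite -E => /setIP[].
Qed.

(** Here A centralizes every abelian subgroup G of 'C_P[x] containing x: its
  centralizer in G contains x as well as G :&: Y, which lies in 'C_Y[x] and is
  maximal in G. Hence G <= G <*> A >= F <*> A is a contraction. *)
Lemma attach_link_conical i : A \subset 'C[x] ->
  exact_at (above (Z <*> <[x]>) 'C_P[x]) i.
Proof.
move=> Ax; set F := (Z <*> <[x]>)%G.
have FC : F \subset 'C_P[x].
  by rewrite join_subG subsetI (subset_trans ZsY YP) cZ //= cycle_subG inE xP cent1id.
have abF : p.-abelem F.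
  by apply: abelem_join; rewrite ?abelem_cycle // cycle_subG -sub_cent1 cZ.
have xF : x \in F by rewrite -cycle_subG joing_subr.
have AP : A \subset 'C_P[x] by rewrite subsetI (subset_trans AY YP).
have FcapY : F :&: Y = Z by apply: (congr1 (@gval gT) cap_join).
have cAG G : G \in above F 'C_P[x] \/ G = F -> A \subset 'C(G).
  move=> GF; have [GC abG xG] : [/\ G \subset 'C_P[x], p.-abelem G & x \in G].
    case: GF => [/aboveP[GC abG FG]|->] //; split=> //.
    exact: (subsetP (proper_sub FG)).
  have GP : G \subset P by apply: subset_trans GC (subsetIl _ _).
  have GYC : G :&: Y \subset 'C_G(A).
    rewrite subsetI subsetIl centsC; apply: subset_trans (centA xPY) (centS _).
    rewrite subsetI subsetIr /= subIset //; apply/orP; left.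
    exact: subset_trans GC (subsetIr _ _).
  suff E : ('C_G(A))%G = G by rewrite centsC -{1}E subsetIr.
  apply/eqP; apply: contraNT xY => nE.
  have E : ('C_G(A))%G = (G :&: Y)%G.
    apply: (index_prime_sandwich GYC (subsetIl _ _) _ nE).
    by rewrite index_cap //; apply/subsetPn; exists x.
  have : x \in ('C_G(A))%G by rewrite inE xG -sub_cent1.
  by rewrite E => /setIP[].
apply: (@exact_join_conical _ _ F A) => [G||G].
- by case/aboveP=> _ _ /proper_sub.
- apply/aboveP; split.
  + by rewrite join_subG FC.
  + by apply: abelem_join => //; apply: cAG; right.
  apply/properP; split; first exact: joing_subl.
  have [_ [a aA aZ]] := properP ZA; exists a.
    by apply: subsetP aA; apply: joing_subr.
  by apply: contra aZ => aF; rewrite -FcapY inE aF (subsetP AY).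
move=> GT; case/aboveP: (GT) => GC abG FG; apply/aboveP; split.
+ by rewrite join_subG GC.
+ by apply: abelem_join => //; apply: cAG; left.
exact: proper_sub_trans FG (joing_subl _ _).
Qed.

(** By 'C_P[x] = 'C_Y[x] \x <[x]> the symplectic space of the link is
  'C_Y[x] / Z, of dimension 2t. *)
Lemma attach_link_sphere : ~~ (A \subset 'C[x]) ->
  (forall i : int, i != (t%:Z - 1)%R ->
     exact_at (above (Z <*> <[x]>) 'C_P[x]) i) /\
  ~ exact_at (above (Z <*> <[x]>) 'C_P[x]) (t%:Z - 1)%R.
Proof.
move=> nAx; have [ZC iC] := centx xPY xp nAx.
have defC := cent1_dprod xP xY xp; have := defC.
case/dprodP=> _ EC cxC tiC.
have abx := abelem_cycle p_pr xp.
have cx : <[x]> \subset 'C(Z) by rewrite cycle_subG -sub_cent1 cZ.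
have defZ : 'Z('C_P[x]) = Z <*> <[x]>.
  rewrite cent_joinEr //; have := center_dprod defC.
  by rewrite ZC (center_idP (abelem_abelian abx)) => /dprodP[].
have ox : #[x] = p by apply: nt_prime_order => //; apply: contraNneq xY => ->.
apply: (@symplectic_homology _ p p_pr Z oZ t ('C_P[x])%G (Z <*> <[x]>)%G) => //.
  split.
  - move=> u; rewrite -[gval _]/'C_P[x] -EC => /mulsgP[d e /setIP[dY dx] ex ->].
    have de : commute d e by apply/esym/(centsP cxC) => //; rewrite inE dY.
    by rewrite expgMn // (expY dY) mul1g; case/abelemP: abx => // _; apply.
  - have := der_dprod 1 defC; rewrite (derG1P (abelem_abelian abx)) dprodg1 /=.
    move=> <-; case: cY => _ dY _.
    exact: subset_trans (dergS 1 (subsetIl _ _)) dY.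
  by rewrite /= defZ joing_subl.
rewrite -divgS /= -?defZ ?subsetIl // defZ.
rewrite cent_joinEr // TI_cardMg; last first.
  apply/trivgP; rewrite -tiC setSI // subsetI ZsY cZ //.
rewrite -EC TI_cardMg // divnMr ?cardG_gt0 // divgS ?iC //.
by rewrite subsetI ZsY cZ.
Qed.

End Link.

Let S := above Z Y.
Let N := above Z P :\: S.

Let TSN : above Z P = S :|: N /\ [disjoint S & N].
Proof.
apply: split_subset; apply/subsetP => F /aboveP[FY abF ZF]; apply/aboveP.
by split=> //; apply: subset_trans YP.
Qed.

Let NP F : F \in N -> [/\ F \subset P, p.-abelem F, Z \proper F & ~~ (F \subset Y)].
Proof.
case/setDP=> /aboveP[FP abF ZF] FS; split=> //.
by apply: contra FS => FY; apply/aboveP.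
Qed.

(** The apex of the cone is F :&: Y. *)
Lemma attach_link_cone F i :
  F \in N -> (F :&: Y)%G != Z -> exact_at (stage_link S N F) i.
Proof.
move=> FN nEF; have [FP abF ZF nFY] := NP FN.
have [ESN _] := TSN.
have ZFY : Z \subset F :&: Y by rewrite subsetI (proper_sub ZF).
have MF : F :&: Y \proper F.
  by rewrite properEneq subsetIl andbT; apply: contraNneq nFY => <-; apply: subsetIr.
have MS : (F :&: Y)%G \in S.
  apply/aboveP; split; first exact: subsetIr.
    by apply: abelemS abF; apply: subsetIl.
  by case: (sub_eq_or_proper (ZFY : Z \subset (F :&: Y)%G)) nEF => // <-; rewrite eqxx.
apply: (@exact_cone _ _ (@gprop_irr gT) (@gprop_trans gT) _ (F :&: Y)%G).
  by rewrite inE in_setU MS; apply/orP; right; apply: MF.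
move=> G; rewrite inE => /andP[_] /orP[FG|/andP[/aboveP[GY _ _] GF]].
  by apply/or3P; apply: Or33; apply: proper_trans FG.
have : G \subset (F :&: Y)%G by rewrite subsetI (proper_sub GF).
by case/sub_eq_or_proper=> [->|->]; rewrite ?eqxx ?orbT.
Qed.

Lemma attach_link_min F x :
    F \in N -> (F :&: Y)%G = Z -> x \in F -> x \notin Y ->
  F = (Z <*> <[x]>)%G /\ stage_link S N F = above (Z <*> <[x]>) 'C_P[x].
Proof.
move=> FN EF xF xY; have [FP abF ZF nFY] := NP FN; have [ESN _] := TSN.
have EFx : F = (Z <*> <[x]>)%G.
  apply/esym/eqP; apply: contraNT xY => nE.
  have E : (Z <*> <[x]>)%G = Z.
    apply: (index_prime_sandwich _ _ _ nE); rewrite ?joing_subl //.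
      by rewrite join_subG proper_sub //= cycle_subG.
    by rewrite -[X in #|_ : gval X|]EF index_cap.
  by apply: (subsetP ZsY); rewrite -[X in x \in gval X]E -cycle_subG joing_subr.
split=> //; apply/setP => G; rewrite inE -ESN -EFx.
apply/andP/aboveP => [[/aboveP[GP abG ZG]]|[]].
  case/orP=> [FG|/andP[/aboveP[GY _ _] GF]]; last first.
    have : G \subset F :&: Y by rewrite subsetI (proper_sub GF).
    have -> : F :&: Y = Z by apply: (congr1 (@gval gT) EF).
    by move/(proper_sub_trans ZG); rewrite properxx.
  split=> //; rewrite subsetI GP sub_cent1.
  apply: (subsetP (abelem_abelian abG)); exact: subsetP (proper_sub FG) x xF.
rewrite subsetI => /andP[GP _] abG FG; split; last by apply/orP; left.
by apply/aboveP; split=> //; apply: proper_trans FG.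
Qed.

(** The subgroups in Y carry homology in degree n - 1 only, by
  symplectic_homology with Y / Z of dimension 2n; the links of the added
  subgroups carry homology in degree t - 1 only, and that of x0 does carry it. *)
Theorem attachment_homology : t != n ->
  [/\ forall i : int, i != t%:Z -> i != (n%:Z - 1)%R -> exact_at (above Z P) i,
      ~ exact_at (above Z P) t%:Z & ~ exact_at (above Z P) (n%:Z - 1)%R].
Proof.
move=> ntn; have [-> dSN] := TSN.
have [exS nexS] := symplectic_homology p_pr oZ cY ZY iYZ.
have linkE F i : F \in N -> i != (t%:Z - 1)%R -> exact_at (stage_link S N F) i.
  move=> FN nit; have [FP abF _ nFY] := NP FN.
  have [EF|nEF] := eqVneq (F :&: Y)%G Z; last exact: attach_link_cone.
  have [x xF xY] := subsetPn nFY; have xP := subsetP FP x xF.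
  have xp : x ^+ p = 1 by case/abelemP: abF => // _ /(_ x xF).
  have [_ ->] := attach_link_min FN EF xF xY.
  have [Ax|nAx] := boolP (A \subset 'C[x]); first exact: attach_link_conical.
  by case: (attach_link_sphere xP xY xp nAx) => ex _; apply: ex.
have [x0inP x0Y] := setDP x0P.
pose F0 := (Z <*> <[x0]>)%G.
have x0F : x0 \in F0 by rewrite -cycle_subG joing_subr.
have F0N : F0 \in N.
  rewrite inE andbC; apply/andP; split.
    apply/aboveP; split.
    - by rewrite join_subG cycle_subG x0inP (subset_trans ZsY YP).
    - by apply: abelem_join; rewrite ?abelem_cycle // cycle_subG -sub_cent1 cZ.
    apply/properP; split; first exact: joing_subl.
    by exists x0 => //; apply: contra x0Y; apply: subsetP.
  by apply/aboveP => -[/subsetP/(_ x0 x0F)]; rewrite (negPf x0Y).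
have nexF0 : ~ exact_at (stage_link S N F0) (t%:Z - 1)%R.
  have [_ ->] := attach_link_min F0N (cap_join x0inP x0Y x0p) x0F x0Y.
  by case: (attach_link_sphere x0inP x0Y x0p x0A).
split=> [i nit nin||].
- apply: (exact_extend (@gprop_irr gT) (@gprop_trans gT) dSN); first exact: exS.
  by move=> F FN; apply: (linkE _ _ FN); apply: contra nit => /eqP/addIr->.
- apply: (nonexact_extend_new (@gprop_irr gT) (@gprop_trans gT) dSN _ F0N nexF0).
  + by apply: exS; apply: contra ntn => /eqP/addIr[->].
  + by move=> F FN; apply: (linkE _ _ FN); rewrite -subr_eq0 subKr.
  by move=> F FN; apply: (linkE _ _ FN); rewrite -subr_eq0 addrAC subrr sub0r.
apply: (nonexact_extend_old (@gprop_irr gT) (@gprop_trans gT) dSN nexS).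
move=> F FN; apply: (linkE _ _ FN); apply: contra ntn => /eqP/addIr[->] //.
Qed.
End Attachment.

(** * Restriction to the subgroups above a central subgroup *)

Section CentralSubgroup.
Local Open Scope group_scope.
Variables (gT : finGroupType) (p : nat) (P Z : {group gT}).
Hypotheses (p_pr : prime p) (oZ : #|Z| = p) (ZP : Z \subset 'Z(P)).

Implicit Types e F : {group gT}.
Local Notation lt := (@group_proper gT).

Let abZ : p.-abelem Z.
Proof. by apply: prime_abelem. Qed.

Let A_ge2P F :
  reflect [/\ F \subset P, p.-abelem F & (p ^ 2 <= #|F|)%N] (F \in A_ge2 p P).
Proof.
rewrite inE; apply: (iffP andP) => [[/pElemP[]]|[? ? ?]] //.
by split=> //; apply/pElemP.
Qed.

(** A subgroup e that does not contain Z is added when no smaller one outside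
  above p Z P is present; nothing in above p Z P lies under e, so its link is
  the set of larger subgroups, which contracts by F <= F <*> Z >= e <*> Z. *)
Lemma A_ge2_exactE i :
  exact_at lt (A_ge2 p P) i <-> exact_at lt (above p Z P) i.
Proof.
set S := above p Z P; set N := A_ge2 p P :\: S.
have [ESN dSN] : A_ge2 p P = S :|: N /\ [disjoint S & N].
  apply: split_subset; apply/subsetP => F /aboveP[FP abF ZF].
  apply/A_ge2P; split=> //.
  have [[|[|r]] E] := p_natP (abelem_pgroup abF); rewrite ?E.
  - by have := proper_card ZF; rewrite E oZ ltnNge prime_gt0.
  - by have := proper_card ZF; rewrite E oZ ltnn.
  by rewrite (leq_exp2l _ _ (prime_gt1 p_pr)).
have linkE e j : e \in N -> exact_at lt (stage_link lt S N e) j.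
  case/setDP=> /A_ge2P[eP abe ge2] eS.
  have Ze : ~~ (Z \subset e).
    apply: contra eS => Ze; apply/aboveP; split=> //.
    rewrite properE Ze; apply/negP => /subset_leq_card; rewrite oZ.
    apply/negP; rewrite -ltnNge (leq_trans _ ge2) // -{1}(expn1 p).
    by rewrite (ltn_exp2l _ _ (prime_gt1 p_pr)).
  have cZ F : F \subset P -> Z \subset 'C(F).
    by move=> FP; apply: subset_trans (centS FP); rewrite (subset_trans ZP) ?subsetIr.
  have linkP F : reflect [/\ F \subset P, p.-abelem F & e \proper F]
      (F \in stage_link lt S N e).
    rewrite inE -ESN; apply: (iffP andP) => [[/A_ge2P[FP abF _]]|[FP abF eF]].
      case/orP=> [//|/andP[/aboveP[_ _ ZF] Fe]]; case/negP: Ze.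
      exact: subset_trans (proper_sub ZF) (proper_sub Fe).
    split; last by apply/orP; left.
    apply/A_ge2P; split=> //; apply: leq_trans ge2 _.
    exact/subset_leq_card/proper_sub.
  apply: (@exact_join_conical _ _ e Z) => [F||F].
  - by case/linkP=> _ _ /proper_sub.
  - apply/linkP; split.
    + by rewrite join_subG eP (subset_trans ZP) ?subsetIl.
    + by apply: abelem_join => //; apply: cZ.
    by rewrite properE joing_subl join_subG subxx.
  case/linkP=> FP abF eF; apply/linkP; split.
  + by rewrite join_subG FP (subset_trans ZP) ?subsetIl.
  + by apply: abelem_join => //; apply: cZ.
  exact: proper_sub_trans eF (joing_subl _ _).
rewrite ESN; split=> [|exS].
  apply: contraPP => nexS.
  apply: (nonexact_extend_old (@gprop_irr gT) (@gprop_trans gT) dSN nexS).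
  by move=> e eN; apply: linkE.
apply: (exact_extend (@gprop_irr gT) (@gprop_trans gT) dSN exS).
by move=> e eN; apply: linkE.
Qed.

End CentralSubgroup.

(** * A translation-invariant alternating form on polynomials *)

Section DerivativeForm.
Variables (p m : nat).
Hypotheses (p_pr : prime p) (mp : (m < p)%N).
Local Notation F := 'F_p.
Implicit Types (f g h q : {poly F}) (a c : F).

Let natF_eq0 j : (0 < j < p)%N -> (j%:R : F) != 0.
Proof.
move=> /andP[j0 jp]; rewrite -(dvdn_pcharf (pchar_Fp p_pr)).
by rewrite gtnNdvd.
Qed.

Let factF_neq0 j : (j < p)%N -> (j`!%:R : F) != 0.
Proof.
elim: j => [|j IH] jp; first by rewrite oner_neq0.
by rewrite factS natrM mulf_neq0 //; [apply: natF_eq0 | apply/IH/ltnW].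
Qed.

(** A nonconstant coefficient of q gets multiplied by its index, which is
  invertible below p. *)
Lemma deriv_eq0_const q : (size q <= p)%N -> q^`() = 0 -> q = (q`_0)%:P.
Proof.
move=> sq dq; apply/polyP => -[|j]; rewrite coefC //=.
have [jp|jp] := leqP p j.+1; first by apply: nth_default; apply: leq_trans jp.
have : q^`()`_j = 0 by rewrite dq coef0.
have nz : (j.+1%:R : F) != 0 by apply: natF_eq0.
by rewrite coef_deriv -mulr_natr => /eqP; rewrite mulf_eq0 (negPf nz) orbF => /eqP.
Qed.

Lemma size_derivn_le n s q : (size q <= s)%N -> (size q^`(n) <= s - n)%N.
Proof.
move=> sq; apply/leq_sizeP => j sj; rewrite coef_derivn nth_default ?mul0rn //.
by rewrite (leq_trans sq) // -leq_subLR.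
Qed.

Definition translate a q := q \Po ('X + a%:P).

Lemma translate0 q : translate 0 q = q.
Proof. by rewrite /translate addr0 comp_polyXr. Qed.

Lemma translateD a b q : translate (a + b) q = translate a (translate b q).
Proof.
rewrite /translate -comp_polyA comp_polyD comp_polyX comp_polyC.
by rewrite polyCD addrA.
Qed.

Lemma size_translate a q : size (translate a q) = size q.
Proof. by rewrite size_comp_poly2 // size_XaddC. Qed.

Lemma derivn_translate n a q : (translate a q)^`(n) = translate a q^`(n).
Proof.
elim: n => // n IH; rewrite derivnS IH deriv_comp derivD derivX derivC addr0 mulr1.
by rewrite -derivnS.
Qed.

(** The multiples of a exhaust F_p, so q - q(0) has p roots and size at most
  p. *)
Lemma translate_fixed_const a q :
  a != 0 -> (size q <= p)%N -> translate a q = q -> q = (q`_0)%:P.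
Proof.
move=> a0 sq aq; pose r := q - (q.[0])%:P.
have qa x : q.[x + a] = q.[x].
  by rewrite -[in RHS]aq /translate horner_comp !hornerE.
have qn j : q.[a *+ j] = q.[0].
  by elim: j => // j IH; rewrite mulrSr qa.
have r0 : r = 0.
  apply/eqP; apply: contraT => rn0.
  suff rF : all (root r) (enum F).
    have := max_poly_roots rn0 rF (enum_uniq _); rewrite -cardE card_Fp // ltnNge.
    rewrite (leq_trans (size_polyD _ _)) // geq_max sq size_polyN.
    by rewrite (leq_trans (size_polyC_leq1 _)) ?prime_gt0.
  apply/allP => x _; rewrite rootE !hornerE.
  have -> : x = a *+ (x / a : F).
    by rewrite -mulr_natr natr_Zp mulrC divfK.
  by rewrite qn subrr.
by move/eqP: r0; rewrite subr_eq0 => /eqP->; rewrite coefC.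
Qed.

(** The bilinear concomitant of the operator (d/dX)^m, applied to the
  derivatives of f and g. *)
Definition dform f g : {poly F} :=
  \sum_(i < m) (-1) ^+ i *: (f^`(i.+1) * g^`(m - i)).

Definition pform f g : F := (dform f g)`_0.

Lemma dformDl f f' g : dform (f + f') g = dform f g + dform f' g.
Proof.
by rewrite -big_split; apply: eq_bigr => i _; rewrite derivnD mulrDl scalerDr.
Qed.

Lemma dformDr f g g' : dform f (g + g') = dform f g + dform f g'.
Proof.
by rewrite -big_split; apply: eq_bigr => i _; rewrite derivnD mulrDr scalerDr.
Qed.

Lemma pformDl f f' g : pform (f + f') g = pform f g + pform f' g.
Proof. by rewrite /pform dformDl coefD. Qed.

Lemma pformDr f g g' : pform f (g + g') = pform f g + pform f g'.
Proof. by rewrite /pform dformDr coefD. Qed.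

Lemma pformZr c f g : pform f (c *: g) = c * pform f g.
Proof.
rewrite /pform -coefZ; congr ((polyseq _)`_0); rewrite /dform scaler_sumr.
apply: eq_bigr => i _.
by rewrite derivnZ -scalerAr !scalerA mulrC.
Qed.

Lemma pformC0 c g : pform c%:P g = 0.
Proof.
rewrite /pform /dform big1 ?coef0 // => i _.
by rewrite derivSn derivC linear0 mul0r scaler0.
Qed.

(** The derivative of the sum telescopes, and its two end terms contain
  derivatives of order m + 1. *)
Lemma dform_const f g : (size f <= m.+1)%N -> (size g <= m.+1)%N ->
  dform f g = (pform f g)%:P.
Proof.
move=> sf sg; apply: deriv_eq0_const.
  apply: leq_trans (size_sum _ _ _) _; apply/bigmax_leqP => i _.
  apply: leq_trans (size_scale_leq _ _) _; apply: leq_trans (size_polyMleq _ _) _.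
  have := size_derivn_le i.+1 sf; have := size_derivn_le (m - i) sg.
  by case: i => i /= im; lia.
rewrite raddf_sum /=.
pose b i := (-1) ^+ i *: (f^`(i.+1) * g^`((m - i).+1)).
rewrite (eq_bigr (fun i : 'I_m => b i - b i.+1)); last first.
  case=> i /= im _; rewrite /b derivZ derivM -!derivnS subnS prednK ?subn_gt0 //.
  by rewrite exprS mulN1r scaleNr opprK addrC scalerDr.
rewrite -(big_mkord xpredT (fun i => b i - b i.+1)).
rewrite -[LHS]opprK -sumrN; under eq_bigr do rewrite opprB.
rewrite telescope_sumr // /b subn0 !(@derivn_poly0 _ _ m.+1) //.
by rewrite mul0r mulr0 !scaler0 subrr oppr0.
Qed.

Lemma pform_translate a f g : (size f <= m.+1)%N -> (size g <= m.+1)%N ->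
  pform (translate a f) (translate a g) = pform f g.
Proof.
move=> sf sg; rewrite {1}/pform.
suff -> : dform (translate a f) (translate a g) = translate a (dform f g).
  by rewrite dform_const // /translate comp_polyC coefC.
rewrite /dform [RHS]raddf_sum; apply: eq_bigr => i _.
by rewrite !derivn_translate /translate /= comp_polyZ comp_polyM.
Qed.

(** Reversing the order of summation exchanges f and g and changes the sign of
  each term by (-1) ^+ m.-1. *)
Lemma pform_anti f g : ~~ odd m -> pform g f = - pform f g.
Proof.
move=> em; rewrite /pform -coefN; congr ((polyseq _)`_0).
rewrite /dform (reindex_inj rev_ord_inj) -sumrN; apply: eq_bigr => -[i im] _ /=.
rewrite -!derivnS subnSK // subKn // mulrC -scaleNr; congr (_ *: _).
rewrite -signr_odd -[in RHS]signr_odd oddB // (negPf em) /=.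
by case: (odd i); rewrite ?opprK.
Qed.

Lemma pform_self f : odd p -> ~~ odd m -> pform f f = 0.
Proof.
move=> op em; have /eqP := pform_anti f f em.
rewrite -addr_eq0 -mulr2n -mulr_natr mulf_eq0.
have /negPf-> : (2%:R : F) != 0.
  apply: natF_eq0; rewrite /= ltn_neqAle prime_gt1 // andbT.
  by apply: contraL op => /eqP<-.
by rewrite orbF => /eqP.
Qed.

Lemma pformXn f j : (j < m)%N ->
  pform f 'X^(m - j) = (-1) ^+ j * (f`_j.+1 * (j.+1)`!%:R * (m - j)`!%:R).
Proof.
move=> jm; rewrite /pform /dform coef_sum (bigD1 (Ordinal jm)) //= big1 ?addr0.
  rewrite coefZ coef0M -derivnS !coef_derivn !addn0 !ffactnn coefXn eqxx.
  by rewrite -(mulr_natr f`_j.+1) mulrA.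
move=> i; rewrite -val_eqE /= => ij.
rewrite coefZ coef0M !coef_derivn coefXn !addn0.
rewrite (_ : (m - i == m - j)%N = false) ?mul0rn ?mulr0 //.
by apply: contraNF ij => /eqP E; have := ltn_ord i; lia.
Qed.

(** The monomials detect the coefficients of f, by pformXn; the factorials
  involved are invertible since m < p. *)
Lemma pform_nondegenerate f : (size f <= m.+1)%N ->
  (forall g, (size g <= m.+1)%N -> pform f g = 0) -> f = (f`_0)%:P.
Proof.
move=> sf f0; apply/polyP => -[|j]; rewrite coefC //=.
have [jm|jm] := ltnP j m; last by apply: nth_default; apply: leq_trans sf _.
have sX : (size ('X^(m - j) : {poly F}) <= m.+1)%N.
  by rewrite size_polyXn ltnS leq_subr.
have /eqP := f0 _ sX; rewrite pformXn // mulf_eq0 signr_eq0 /= !mulf_eq0.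
have /negPf-> := factF_neq0 (leq_ltn_trans jm mp).
have /negPf-> := factF_neq0 (leq_ltn_trans (leq_subr j m) mp).
by rewrite !orbF => /eqP.
Qed.

(** As m >= 2, each term of the form contains a derivative of order at least 2. *)
Lemma pform_size2 f g : (1 < m)%N -> (size f <= 2)%N -> (size g <= 2)%N ->
  pform f g = 0.
Proof.
move=> m1 sf sg; rewrite /pform /dform big1 ?coef0 // => -[[|i] im] _ /=.
  by rewrite subn0 (derivn_poly0 (leq_trans sg m1)) mulr0 scaler0.
by rewrite -!derivnS (@derivn_poly0 _ f) ?mul0r ?scaler0 // (leq_trans sf).
Qed.

Lemma size2_polyE f : (size f <= 2)%N -> f = f`_1 *: 'X + (f`_0)%:P.
Proof.
move=> sf; apply/polyP => -[|[|j]]; rewrite coefD coefZ coefX coefC /=.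
- by rewrite mulr0 add0r.
- by rewrite mulr1 addr0.
by rewrite mulr0 addr0 nth_default // (leq_trans sf).
Qed.

Lemma pform_size2r h f : ~~ odd m -> (size f <= 2)%N ->
  pform h f = f`_1 * pform h 'X.
Proof.
move=> em /size2_polyE {1}->; rewrite pformDr pformZr.
by rewrite (pform_anti (f`_0)%:P h em) pformC0 oppr0 addr0.
Qed.

(** The derivative of such an f is invariant under translation, hence
  constant. *)
Lemma translate_eq_addC a c f : a != 0 -> (size f <= p)%N ->
  translate a f = f + c%:P <-> (size f <= 2)%N /\ f`_1 * a = c.
Proof.
move=> a0 sf; split=> [E|[/size2_polyE Ef <-]]; last first.
  move: (f`_1) (f`_0) Ef => u v ->.
  rewrite /translate comp_polyD comp_polyZ comp_polyX comp_polyC.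
  by rewrite scalerDr -!addrA; congr (_ + _); rewrite addrC -mul_polyC polyCM.
have s2 : (size f <= 2)%N.
  have df : translate a f^`() = f^`().
    by rewrite -(derivn_translate 1) E derivn1 derivD derivC addr0.
  have sdf : (size f^`() <= p)%N.
    by apply: leq_trans (size_derivn_le 1 sf) (leq_subr _ _).
  have Edf := translate_fixed_const a0 sdf df.
  apply/leq_sizeP => -[|[|j]] // _.
  have [jp|jp] := leqP p j.+2; first by apply: nth_default; apply: leq_trans jp.
  have nz : (j.+2%:R : F) != 0 by apply: natF_eq0.
  have := congr1 (fun q : {poly F} => q`_j.+1) Edf.
  rewrite coef_deriv coefC /= -mulr_natr => /eqP.
  by rewrite mulf_eq0 (negPf nz) orbF => /eqP.
split=> //; have := congr1 (fun q : {poly F} => q`_0) E.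
rewrite /= coefD coefC /= [in LHS](size2_polyE s2).
rewrite /translate comp_polyD comp_polyZ comp_polyX comp_polyC scalerDr.
rewrite !coefD coefZ coefX mulr0 add0r coefZ !coefC /= addrC => /addrI ->//.
Qed.

End DerivativeForm.

(** * Heisenberg groups extended by an action of F_p *)

HB.instance Definition _ (A B : finZmodType) := GRing.Zmodule.on (A * B)%type.

(** The module H = hmod is the set of elements of a Heisenberg group, with
  product g + h + hcen (hform g h). Its centre hcen is not split off as a
  direct factor because the action of F_p need not preserve a complement. *)
Structure heisenberg_action (p : nat) := HeisenbergAction {
  hmod :> finZmodType;
  hcen : 'F_p -> hmod;
  hform : hmod -> hmod -> 'F_p;
  hact : 'F_p -> hmod -> hmod;
  hmod_exp : forall h : hmod, h *+ p = 0;
  hcenD : {morph hcen : a b / a + b};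
  hcen_inj : injective hcen;
  hformDl : forall h, {morph hform^~ h : f g / f + g};
  hform_anti : forall g h, hform h g = - hform g h;
  hform_self : forall h, hform h h = 0;
  hform_cen : forall c h, hform (hcen c) h = 0;
  hactD : forall a, {morph hact a : g h / g + h};
  hact0 : forall h, hact 0 h = h;
  hact_add : forall a b h, hact (a + b) h = hact a (hact b h);
  hact_cen : forall a c, hact a (hcen c) = hcen c;
  hform_act : forall a g h, hform (hact a g) (hact a h) = hform g h }.

Section ExtendedHeisenberg.
Variables (p : nat) (D : heisenberg_action p).
Implicit Types (a b c : 'F_p) (g h : D).
Local Notation cen := (@hcen p D).
Local Notation form := (@hform p D).
Local Notation act := (@hact p D).

Lemma hformDr g h k : form g (h + k) = form g h + form g k.
Proof. by rewrite hform_anti hformDl opprD -!(hform_anti _ g). Qed.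

Lemma hform0l h : form 0 h = 0.
Proof. by apply: (addrI (form 0 h)); rewrite -hformDl !addr0. Qed.

Lemma hform0r h : form h 0 = 0.
Proof. by rewrite hform_anti hform0l oppr0. Qed.

Lemma hformNl g h : form (- g) h = - form g h.
Proof. by apply: (addrI (form g h)); rewrite -hformDl !subrr hform0l. Qed.

Lemma hform_cenr h c : form h (cen c) = 0.
Proof. by rewrite hform_anti hform_cen oppr0. Qed.

Lemma hcen0 : cen 0 = 0.
Proof. by apply: (addrI (cen 0)); rewrite -hcenD !addr0. Qed.

Lemma hact_0 a : act a 0 = 0.
Proof. by apply: (addrI (act a 0)); rewrite -hactD !addr0. Qed.

Lemma hactN a h : act a (- h) = - act a h.
Proof. by apply: (addrI (act a h)); rewrite -hactD !subrr hact_0. Qed.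

Definition ext_heis : Type := ('F_p * hmod D)%type.
HB.instance Definition _ := Finite.on ext_heis.

(** The semidirect product of the Heisenberg group by F_p, where (a, h) stands
  for the translation by a followed by h. *)
Definition eh_mul (x y : ext_heis) : ext_heis :=
  (x.1 + y.1, act y.1 x.2 + y.2 + cen (form (act y.1 x.2) y.2)).
Definition eh_one : ext_heis := (0, 0).
Definition eh_inv (x : ext_heis) : ext_heis := (- x.1, - act (- x.1) x.2).

Lemma eh_mulA : associative eh_mul.
Proof.
move=> [a h] [b g] [c k]; rewrite /eh_mul /= addrA; congr (_, _).
rewrite (addrC b c) hact_add !hactD hact_cen !hformDl !hformDr.
rewrite hform_act hform_cen hform_cenr !addr0 !hcenD -!addrA.
do 2!congr (_ + _); rewrite [RHS]addrCA; congr (_ + _).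
by rewrite addrC -addrA.
Qed.

Lemma eh_mul1 : left_id eh_one eh_mul.
Proof.
by move=> [a h]; rewrite /eh_mul /= hact_0 hform0l hcen0 addr0 !add0r.
Qed.

Lemma eh_mulV : left_inverse eh_one eh_inv eh_mul.
Proof.
move=> [a h]; rewrite /eh_mul /= hactN -hact_add subrr hact0 !addNr.
by rewrite hformNl hform_self oppr0 hcen0 addr0.
Qed.

HB.instance Definition _ := Finite_isGroup.Build ext_heis eh_mulA eh_mul1 eh_mulV.

Lemma eh_mulE a b g h :
  (((a, g) : ext_heis) * ((b, h) : ext_heis))%g =
  (a + b, act b g + h + cen (form (act b g) h)) :> ext_heis.
Proof. by []. Qed.

Lemma eh_expgY h n : (((0, h) : ext_heis) ^+ n)%g = (0, h *+ n) :> ext_heis.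
Proof.
elim: n => // n IH; rewrite expgS IH eh_mulE hact0 addr0 mulrS.
suff -> : form h (h *+ n) = 0 by rewrite hcen0 addr0.
by elim: n {IH} => [|n IH]; rewrite ?hform0r // mulrS hformDr hform_self IH addr0.
Qed.

Lemma eh_expg_act a n : (((a, 0) : ext_heis) ^+ n)%g = (a *+ n, 0) :> ext_heis.
Proof.
elim: n => // n IH.
by rewrite expgS IH eh_mulE hact_0 hform0l hcen0 !addr0 mulrS.
Qed.

Lemma hcenN c : cen (- c) = - cen c.
Proof. by apply: (addrI (cen c)); rewrite -hcenD !subrr hcen0. Qed.

(** Central terms do not affect the form, so hform (hact a g) h can be replaced
  by hform g h once hact a g and g are known to differ by a central element. *)
Lemma eh_commuteP a g h :
  commute ((0, g) : ext_heis) ((a, h) : ext_heis) <->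
  act a g = g + cen (form h g *+ 2).
Proof.
rewrite /commute !eh_mulE add0r addr0 hact0; split=> [[E]|->]; last first.
  congr (_, _); rewrite hformDl hform_cen addr0 [form g h]hform_anti mulr2n.
  by rewrite hcenD hcenN addrAC addrA addrK addrAC [g + h]addrC.
have Eg : act a g = g + cen (form h g - form (act a g) h).
  apply: (addIr (h + cen (form (act a g) h))).
  rewrite addrA E hcenD hcenN [h + cen _]addrC.
  by rewrite addrA -(addrA g) addrNK [RHS]addrAC [g + h]addrC.
have Ef : form (act a g) h = form g h by rewrite Eg hformDl hform_cen addr0.
by rewrite Eg Ef [form g h]hform_anti opprK -mulr2n.
Qed.

Hypotheses (p_pr : prime p) (p_odd : odd p).

Lemma Fp_mul2 c : c *+ 2 = 0 -> c = 0.
Proof.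
move=> /eqP; rewrite -mulr_natr mulf_eq0 => /orP[/eqP//|].
rewrite -(dvdn_pcharf (pchar_Fp p_pr)) => /dvdn_leq p2.
have E2 : p = 2 by apply/eqP; rewrite eqn_leq p2 ?prime_gt1.
by have := p_odd; rewrite [odd p](congr1 odd E2).
Qed.

Lemma heis_set_group : group_set [set x : ext_heis | x.1 == 0].
Proof.
apply/group_setP; split=> [|[a g] [b h]]; rewrite !inE //= => /eqP-> /eqP->.
by rewrite addr0.
Qed.
Definition heis_group := Group heis_set_group.

Lemma heis_groupE x : (x \in heis_group) = (x.1 == 0).
Proof. by rewrite inE. Qed.

Lemma heis_cen_group_set :
  group_set [set x : ext_heis | [exists c, x == (0, cen c)]].
Proof.
apply/group_setP; split=> [|x y]; rewrite !inE.
  by apply/existsP; exists 0; rewrite hcen0.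
move=> /existsP[a /eqP->] /existsP[b /eqP->]; apply/existsP; exists (a + b).
by rewrite eh_mulE hact0 hform_cen hcen0 !addr0 hcenD.
Qed.
Definition heis_cen_group := Group heis_cen_group_set.

Lemma heis_cenP x : reflect (exists c, x = (0, cen c)) (x \in heis_cen_group).
Proof.
rewrite inE; apply: (iffP existsP) => -[c]; last by move->; exists c.
by move/eqP->; exists c.
Qed.

Lemma card_heis_cen : #|heis_cen_group| = p.
Proof.
have -> : heis_cen_group = [set ((0, cen c) : ext_heis) | c in 'F_p] :> {set _}.
  apply/setP => x; apply/heis_cenP/imsetP => -[c]; first by exists c.
  by move=> _ ->; exists c.
by rewrite card_imset ?card_Fp // => a b [/hcen_inj].
Qed.

Lemma heis_cen_central : heis_cen_group \subset 'Z([set: ext_heis])%g.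
Proof.
apply/subsetP => _ /heis_cenP[c ->]; rewrite inE inE; apply/centP => -[a h] _.
by apply/eh_commuteP; rewrite hact_cen hform_cenr mul0rn hcen0 addr0.
Qed.

Lemma heis_normal : (heis_group <| [set: ext_heis]%G)%g.
Proof.
apply/normalP; split=> [|x _]; first exact: subsetT.
suff sub (z : ext_heis) : (heis_group :^ z)%g \subset heis_group.
  apply/eqP; rewrite eqEsubset sub -sub_conjgV. exact: sub.
apply/subsetP => _ /imsetP[y yY ->].
move: yY; rewrite !heis_groupE /= => /eqP->.
by rewrite add0r addNr.
Qed.

Lemma heis_class2 : class2_over p heis_cen_group heis_group.
Proof.
split.
- move=> [a h]; rewrite heis_groupE /= => /eqP a0.
  by rewrite a0 eh_expgY hmod_exp.
- rewrite derg1 gen_subG; apply/subsetP => _ /imset2P[[a g] [b h] gY hY ->].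
  move: gY hY; rewrite !heis_groupE /= => /eqP-> /eqP->.
  apply/heis_cenP; exists (form g h *+ 2).
  apply: (mulgI (((0, h) : ext_heis) * ((0, g) : ext_heis))%g); rewrite -commgC.
  rewrite !eh_mulE !hact0 hform_cenr hcen0 !addr0; congr (_, _).
  rewrite -[RHS]addrA -hcenD [form h g]hform_anti mulr2n addrA addNr add0r.
  by rewrite [g + h]addrC.
rewrite subsetI; apply/andP; split.
  by apply/subsetP => _ /heis_cenP[c ->]; rewrite heis_groupE.
apply: subset_trans heis_cen_central _; by rewrite subIset // centS ?orbT ?subsetT.
Qed.

Lemma heis_cen_sub : heis_cen_group \subset heis_group.
Proof. by case: heis_class2 => _ _; rewrite subsetI => /andP[]. Qed.

(** The commutator is twice the form, and p is odd. *)
Lemma heis_commuteP g h :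
  commute ((0, g) : ext_heis) ((0, h) : ext_heis) <-> form g h = 0.
Proof.
rewrite eh_commuteP hact0; split=> [/esym/eqP|fgh].
  rewrite -subr_eq0 [g + _]addrC addrK -hcen0 => /eqP/hcen_inj/Fp_mul2 fhg.
  by rewrite hform_anti fhg oppr0.
by rewrite hform_anti fgh oppr0 mul0rn hcen0 addr0.
Qed.

Lemma heis_center :
    (forall h, (forall g, form h g = 0) -> exists c, h = cen c) ->
  'Z(heis_group)%g = heis_cen_group.
Proof.
move=> nondeg; apply/eqP; rewrite eqEsubset andbC; apply/andP; split.
  by case: heis_class2.
apply/subsetP => -[a h] /setIP[]; rewrite heis_groupE /= => /eqP-> /centP ch.
have [|c ->] := nondeg h; last by apply/heis_cenP; exists c.
by move=> g; apply/heis_commuteP/ch; rewrite heis_groupE.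
Qed.

Lemma card_heis : #|heis_group| = #|hmod D|.
Proof.
have -> : heis_group = [set ((0, h) : ext_heis) | h : D] :> {set _}.
  apply/setP => -[a h]; rewrite heis_groupE.
  apply/eqP/imsetP => /= [->|[k _ [-> _]]] //.
  by exists h.
by rewrite card_imset // => g h [].
Qed.

Lemma card_ext_heis : #|[set: ext_heis]| = (p * #|hmod D|)%N.
Proof. by rewrite cardsT card_prod card_Fp. Qed.

Lemma index_heis : #|[set: ext_heis]%G : heis_group|%g = p.
Proof.
rewrite -divgS ?subsetT // card_ext_heis card_heis mulnK //.
by apply/card_gt0P; exists 0.
Qed.

End ExtendedHeisenberg.

(** * The group of translations and polynomials *)

Section StandardSymplectic.
Variables (F : finFieldType) (t : nat).
Local Notation W := ('rV[F]_t * 'rV[F]_t)%type.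
Implicit Types u v w : W.

Definition symp u v : F :=
  \sum_j (u.1 0 j * v.2 0 j - u.2 0 j * v.1 0 j).

Lemma sympDl u v w : symp (u + v) w = symp u w + symp v w.
Proof. by rewrite -big_split; apply: eq_bigr => j _; rewrite /= !mxE; ring. Qed.

Lemma symp_anti u v : symp v u = - symp u v.
Proof. by rewrite -sumrN; apply: eq_bigr => j _; ring. Qed.

Lemma symp_self u : symp u u = 0.
Proof. by rewrite /symp big1 // => j _; ring. Qed.

Lemma symp_nondegenerate u : (forall v, symp u v = 0) -> u = 0.
Proof.
case: u => u1 u2 h; congr (_, _); apply/rowP => j; rewrite [RHS]mxE.
  have := h (0, delta_mx 0 j); rewrite /symp (bigD1 j) //= big1.
    by rewrite !mxE !eqxx mulr1 mulr0 subr0 addr0.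
  by move=> k kj; rewrite !mxE (negPf kj) /= !mulr0 subr0.
have := h (delta_mx 0 j, 0); rewrite /symp (bigD1 j) //= big1.
  by rewrite !mxE !eqxx mulr1 mulr0 sub0r addr0 => /eqP; rewrite oppr_eq0 => /eqP.
by move=> k kj; rewrite !mxE (negPf kj) /= !mulr0 subr0.
Qed.

End StandardSymplectic.

Section PolynomialAction.
Variables (p m t : nat).
Hypotheses (p_pr : prime p) (p_odd : odd p).
Hypotheses (m_even : ~~ odd m) (m_gt1 : (1 < m)%N) (m_ltp : (m < p)%N).
Local Notation F := 'F_p.
Local Notation H := ({poly_(m.+1) F} * ('rV[F]_t * 'rV[F]_t))%type.
Implicit Types (g h : H) (a b c : F).

Definition pa_cen c : H := (npolyp m.+1 c%:P, 0).

Definition pa_form g h : F := pform m g.1 h.1 + symp g.2 h.2.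

Lemma size_translate_npoly a (f : {poly_(m.+1) F}) :
  translate a f \is a poly_of_size m.+1.
Proof. by rewrite qualifE /= size_translate size_npoly. Qed.

Definition pa_act a h : H := (NPoly (size_translate_npoly a h.1), h.2).

Lemma pa_cenE c : (pa_cen c).1 = c%:P :> {poly F}.
Proof. by rewrite npolypK // (leq_trans (size_polyC_leq1 _)). Qed.

Lemma pa_eqP g h : (g.1 = h.1 :> {poly F}) -> g.2 = h.2 -> g = h.
Proof. by case: g h => [f w] [f' w'] /= /val_inj-> ->. Qed.

Lemma pa_exp h : h *+ p = 0.
Proof.
by rewrite -(scaler_nat p h) pchar_Fp_0 // scale0r. Qed.

Lemma pa_cenD : {morph pa_cen : a b / a + b}.
Proof.
by move=> a b; apply: pa_eqP => /=; rewrite ?addr0 // !pa_cenE polyCD.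
Qed.

Lemma pa_cen_inj : injective pa_cen.
Proof.
by move=> a b /(congr1 (fun h : H => (h.1 : {poly F})`_0)); rewrite !pa_cenE !coefC.
Qed.

Lemma pa_formDl h : {morph pa_form^~ h : f g / f + g}.
Proof. by move=> f g; rewrite /pa_form /= pformDl sympDl addrACA. Qed.

Lemma pa_form_anti g h : pa_form h g = - pa_form g h.
Proof. by rewrite /pa_form pform_anti // symp_anti opprD. Qed.

Lemma pa_form_self h : pa_form h h = 0.
Proof. by rewrite /pa_form pform_self // symp_self addr0. Qed.

Lemma symp0l (w : 'rV[F]_t * 'rV[F]_t) : symp 0 w = 0.
Proof. by rewrite /symp big1 // => j _; rewrite !mxE !mul0r subr0. Qed.

Lemma pa_form_cen c h : pa_form (pa_cen c) h = 0.
Proof. by rewrite /pa_form pa_cenE pformC0 symp0l addr0. Qed.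

Lemma pa_actD a : {morph pa_act a : g h / g + h}.
Proof. by move=> g h; apply: pa_eqP => //=; rewrite /translate comp_polyD. Qed.

Lemma pa_act0 h : pa_act 0 h = h.
Proof. by apply: pa_eqP => //=; rewrite translate0. Qed.

Lemma pa_act_add a b h : pa_act (a + b) h = pa_act a (pa_act b h).
Proof. by apply: pa_eqP => //=; rewrite translateD. Qed.

Lemma pa_act_cen a c : pa_act a (pa_cen c) = pa_cen c.
Proof. by apply: pa_eqP => //; rewrite /= !pa_cenE /translate comp_polyC. Qed.

Lemma pa_form_act a g h : pa_form (pa_act a g) (pa_act a h) = pa_form g h.
Proof. by rewrite /pa_form /= pform_translate // size_npoly. Qed.

Definition poly_heis := HeisenbergAction pa_exp pa_cenD pa_cen_inj pa_formDl
  pa_form_anti pa_form_self pa_form_cen pa_actD pa_act0 pa_act_add pa_act_cen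
  pa_form_act.

Local Notation D := poly_heis.
Local Notation P := [set: ext_heis D]%G.
Local Notation Y := (heis_group D).
Local Notation Z := (heis_cen_group D).

Lemma poly_heis_nondegenerate (h : D) :
  (forall g, hform h g = 0) -> exists c, h = hcen D c.
Proof.
case: h => f w h0; exists ((f : {poly F})`_0); apply: pa_eqP.
  rewrite [RHS]pa_cenE /=.
  apply: (pform_nondegenerate p_pr m_ltp); rewrite ?size_npoly //.
  move=> g sg; have := h0 (npolyp m.+1 g, 0).
  by rewrite /= /pa_form /= npolypK // symp_anti symp0l oppr0 addr0.
apply: symp_nondegenerate => v; have := h0 (0, v).
by rewrite /= /pa_form /= pform_anti // -polyC0 pformC0 oppr0 add0r.
Qed.

Lemma card_poly_heis : #|hmod D| = (p ^ (m.+1 + 2 * t))%N.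
Proof.
rewrite /= !card_prod card_npoly !card_mx card_Fp // mul1n -!expnD.
by congr (_ ^ (_ + _))%N; rewrite mul2n addnn.
Qed.

Lemma index_poly_heis : #|Y : Z|%g = (p ^ (m + 2 * t))%N.
Proof.
rewrite -divgS ?heis_cen_sub // card_heis card_poly_heis card_heis_cen //.
by rewrite addSn expnS mulKn // prime_gt0.
Qed.

Lemma affine_group_set : group_set
  [set x : ext_heis D | [&& x.1 == 0, (size (x.2.1 : {poly F}) <= 2)%N & x.2.2 == 0]].
Proof.
apply/group_setP; split=> [|[a [f w]] [b [g v]]].
  by rewrite inE /= !eqxx size_poly0.
rewrite 2!inE /= => /and3P[/eqP-> sf /eqP->] /and3P[/eqP-> sg /eqP->].
rewrite eh_mulE hact0 inE /= !addr0 !eqxx andbT /=.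
rewrite npolypK ?(leq_trans (size_polyC_leq1 _)) //.
apply: leq_trans (size_polyD _ _) _; rewrite geq_max.
rewrite (leq_trans (size_polyC_leq1 _)) // andbT.
by apply: leq_trans (size_polyD _ _) _; rewrite geq_max sf.
Qed.
Definition affine_group := Group affine_group_set.
Local Notation A := affine_group.

Lemma affine_groupE x : (x \in A) =
  [&& x.1 == 0, (size (x.2.1 : {poly F}) <= 2)%N & x.2.2 == 0].
Proof. by rewrite inE. Qed.

Lemma affine_sub : A \subset Y.
Proof. by apply/subsetP => x; rewrite affine_groupE heis_groupE => /and3P[]. Qed.

Lemma pa_form_affine (g h : D) :
    (size (g.1 : {poly F}) <= 2)%N -> (size (h.1 : {poly F}) <= 2)%N ->
  hform g h = symp g.2 h.2.
Proof. by move=> sg sh; rewrite /= /pa_form pform_size2 // add0r. Qed.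

Lemma affine_abelian : abelian A.
Proof.
apply/centsP => -[a [f w]] + [b [g v]]; rewrite !affine_groupE /=.
move=> /and3P[/eqP-> sf /eqP->] /and3P[/eqP-> sg /eqP->].
by apply/(heis_commuteP p_pr p_odd); rewrite pa_form_affine // symp0l.
Qed.

Definition affine_poly b c : {poly_(m.+1) F} := npolyp m.+1 (b *: 'X + c%:P).

Lemma affine_polyE b c : affine_poly b c = b *: 'X + c%:P :> {poly F}.
Proof.
rewrite npolypK // (leq_trans (size_polyD _ _)) // geq_max.
rewrite (leq_trans (size_scale_leq _ _)) ?size_polyX //=.
by rewrite (leq_trans (size_polyC_leq1 _)).
by rewrite ltnW.
Qed.

Lemma size_affine_poly b c : (size (affine_poly b c : {poly F}) <= 2)%N.
Proof.
rewrite affine_polyE (leq_trans (size_polyD _ _)) // geq_max.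
rewrite (leq_trans (size_scale_leq _ _)) ?size_polyX //=.
by rewrite (leq_trans (size_polyC_leq1 _)).
Qed.

Lemma coef1_affine_poly b c : (affine_poly b c : {poly F})`_1 = b.
Proof. by rewrite affine_polyE coefD coefZ coefX coefC mulr1 addr0. Qed.

(** The condition is hact a g = g + hcen (2 hform h g) from eh_commuteP: the
  polynomial part of g has degree at most one, and translation by a adds a times
  its slope, whereas hform h g depends on the slope and on the vector part. *)
Lemma cent_outside a (h g : D) : a != 0 ->
  reflect ((size (g.1 : {poly F}) <= 2)%N /\
    (g.1 : {poly F})`_1 * a =
      ((g.1 : {poly F})`_1 * pform m h.1 'X + symp h.2 g.2) *+ 2)
  (((0, g) : ext_heis D) \in 'C_Y[((a, h) : ext_heis D)])%g.
Proof.
move=> a0; have sg : (size (g.1 : {poly F}) <= p)%N.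
  by apply: leq_trans (size_npoly _) _.
have E := translate_eq_addC p_pr _ a0 sg.
apply: (iffP idP) => [/setIP[_ /cent1P/eh_commuteP]|].
  move=> Eg; have := congr1 (fun k : D => (k.1 : {poly F})) Eg.
  rewrite /= pa_cenE => /E[s2 E1]; split=> //.
  by rewrite E1 /pa_form (pform_size2r _ m_even s2).
move=> [s2 E1]; rewrite inE heis_groupE eqxx; apply/cent1P/eh_commuteP.
apply: pa_eqP; rewrite /= ?addr0 // pa_cenE.
by apply/E; split=> //; rewrite E1 /pa_form (pform_size2r _ m_even s2).
Qed.

Lemma affine_cent_cent1 (x : ext_heis D) : x \notin Y -> A \subset 'C('C_Y[x])%g.
Proof.
case: x => a h; rewrite heis_groupE /= => a0.
apply/centsP => -[a' g] + [b k] kC; rewrite affine_groupE /=.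
move=> /and3P[/eqP-> sg /eqP g0].
have /setIP[+ _] := kC; rewrite heis_groupE /= => /eqP b0; rewrite b0 in kC *.
have [sk _] := elimT (cent_outside h k a0) kC.
by apply/(heis_commuteP p_pr p_odd); rewrite pa_form_affine // g0 symp0l.
Qed.

Lemma affine_sub_cent1 a (h : D) : a != 0 -> a = pform m h.1 'X *+ 2 ->
  A \subset 'C[((a, h) : ext_heis D)]%g.
Proof.
move=> a0 ab; apply/subsetP => -[a' g].
rewrite affine_groupE /= => /and3P[/eqP-> sg /eqP g0].
suff /setIP[] : ((0, g) : ext_heis D) \in 'C_Y[((a, h) : ext_heis D)]%g by [].
apply/(cent_outside _ _ a0); split=> //.
by rewrite g0 symp_anti symp0l oppr0 addr0 ab -mulrnAr.
Qed.

(** The generating translation sends X to X + 1. *)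
Lemma affine_nsub_cent1 : ~~ (A \subset 'C[((1%R, 0%R) : ext_heis D)])%g.
Proof.
apply/subsetPn; exists (0, (affine_poly 1 0, 0)).
  by rewrite affine_groupE /= !eqxx size_affine_poly.
apply/negP => x1C; have n1 : (1 : F) != 0 by rewrite oner_neq0.
have [|_] := elimT (cent_outside 0 (affine_poly 1 0, 0) n1).
  by apply/setIP; split; first by rewrite heis_groupE.
rewrite /= coef1_affine_poly symp0l -polyC0 pformC0 !mulr0 addr0 mul0rn mulr1.
by apply/eqP.
Qed.

Section NonCentralizing.
Variables (a : F) (h : D).
Hypotheses (a0 : a != 0) (ab : a != pform m h.1 'X *+ 2).

(** Solving the linear equation of cent_outside for the slope; the denominator
  vanishes exactly when (a, h) centralizes the affine polynomials. *)
Definition cent_slope (w : 'rV[F]_t * 'rV[F]_t) : F :=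
  symp h.2 w *+ 2 / (a - pform m h.1 'X *+ 2).

Local Notation C := ('C_Y[((a, h) : ext_heis D)])%g.

Lemma cent_slopeP (g : D) :
  reflect ((size (g.1 : {poly F}) <= 2)%N /\ (g.1 : {poly F})`_1 = cent_slope g.2)
          (((0, g) : ext_heis D) \in C).
Proof.
have nz : a - pform m h.1 'X *+ 2 != 0 by rewrite subr_eq0.
apply: (iffP (cent_outside h g a0)) => -[sg E]; split=> //.
  by apply: (mulIf nz); rewrite divfK // mulrBr E mulrnDl mulrnAr addrAC subrr add0r.
have := congr1 ( *%R^~ (a - pform m h.1 'X *+ 2)) E.
rewrite divfK // mulrBr => /eqP; rewrite subr_eq => /eqP->.
by rewrite mulrnDl mulrnAr addrC.
Qed.

Lemma cent_paramE :
  C = [set ((0, (affine_poly (cent_slope cw.2) cw.1, cw.2)) : ext_heis D)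
        | cw : F * ('rV[F]_t * 'rV[F]_t)].
Proof.
apply/setP => -[b g]; apply/idP/imsetP => [gC|[[c w] _ ->] /=]; last first.
  by apply/cent_slopeP; rewrite size_affine_poly coef1_affine_poly.
have /setIP[+ _] := gC; rewrite heis_groupE /= => /eqP b0; rewrite b0 in gC *.
have /cent_slopeP[sg E] := gC; exists ((g.1 : {poly F})`_0, g.2) => //=.
congr (_, _); apply: pa_eqP => //=; rewrite affine_polyE -E.
exact: size2_polyE.
Qed.

Lemma cent_sub_cen : Z \subset C.
Proof.
apply/subsetP => _ /heis_cenP[c ->]; apply/cent_slopeP => /=.
rewrite npolypK ?(leq_trans (size_polyC_leq1 _)) //; split=> //.
by rewrite coefC /cent_slope symp_anti symp0l oppr0 mul0rn mul0r.
Qed.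

Lemma index_cent_cen : #|C : Z|%g = (p ^ (2 * t))%N.
Proof.
rewrite -divgS ?cent_sub_cen // card_heis_cen //= cent_paramE.
rewrite card_imset => [|[c w] [c' w'] /(congr1 snd)/= E].
  by rewrite !card_prod !card_mx card_Fp // mul1n -expnD mul2n addnn mulKn ?prime_gt0.
have Ew : w = w' := congr1 snd E.
have := congr1 (fun f : D => (f.1 : {poly F})`_0) E.
by rewrite /= !affine_polyE !coefD !coefZ !coefX !coefC /= !mulr0 !add0r Ew => ->.
Qed.

(** On the centralizer the form reduces to the symplectic form of the vector
  parts, so a central element has zero vector part and hence zero slope. *)
Lemma center_cent : 'Z(C)%g = Z.
Proof.
apply/eqP; rewrite eqEsubset; apply/andP; split; last first.
  rewrite subsetI cent_sub_cen; apply: subset_trans (heis_cen_central D) _.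
  by rewrite subIset // centS ?subsetT ?orbT.
apply/subsetP => -[b g] /setIP[gC /centP cg].
have /setIP[+ _] := gC; rewrite heis_groupE /= => /eqP b0; rewrite b0 in gC cg *.
have /cent_slopeP[sg E] := gC.
have g2 : g.2 = 0.
  apply: symp_nondegenerate => w.
  have kC : ((0, (affine_poly (cent_slope w) 0, w)) : ext_heis D) \in C.
    by apply/cent_slopeP; rewrite size_affine_poly coef1_affine_poly.
  have /(heis_commuteP p_pr p_odd) := cg _ kC.
  by rewrite pa_form_affine ?size_affine_poly.
apply/heis_cenP; exists (g.1 : {poly F})`_0; congr (_, _); apply: pa_eqP => //.
rewrite [RHS]pa_cenE {1}(size2_polyE sg) E g2.
by rewrite /cent_slope symp_anti symp0l oppr0 mul0rn mul0r scale0r add0r.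
Qed.

End NonCentralizing.

Theorem poly_heis_homology n : (2 * n = m + 2 * t)%N -> t != n ->
  forall i : int, (exists h : H_A_ge2 p P i, h != 0) <-> i = t \/ i = n%:Z - 1.
Proof.
move=> En ntn i; rewrite /H_A_ge2 /Delta_A_ge2.
have oZ := card_heis_cen D p_pr.
have ZP := heis_cen_central D.
rewrite homology_nontrivialE.
rewrite (A_ge2_exactE p_pr oZ ZP).
have ZA : (Z \proper A)%g.
  apply/properP; split.
    apply/subsetP => _ /heis_cenP[c ->]; rewrite affine_groupE /= !eqxx andbT.
    by rewrite npolypK ?(leq_trans (size_polyC_leq1 _)).
  exists (0, (affine_poly 1 0, 0)).
    by rewrite affine_groupE /= !eqxx size_affine_poly.
  apply/heis_cenP => -[c /(congr1 (fun x : ext_heis D => (x.2.1 : {poly F})`_1))].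
  rewrite /= pa_cenE coef1_affine_poly coefC /= => /eqP.
  by rewrite (negPf (oner_neq0 _)).
have iYZ : #|Y : Z|%g = (p ^ (2 * n))%N by rewrite En index_poly_heis.
have ZY := heis_center p_pr p_odd poly_heis_nondegenerate.
have centA : {in (P :\: Y)%g, forall x, A \subset 'C('C_Y[x])%g}.
  by move=> x /setDP[_ xY]; apply: affine_cent_cent1.
have centx : {in (P :\: Y)%g, forall x, (x ^+ p)%g = 1%g -> ~~ (A \subset 'C[x])%g ->
    'Z('C_Y[x])%g = Z /\ #|'C_Y[x] : Z|%g = (p ^ (2 * t))%N}.
  move=> -[a h] /setDP[_]; rewrite heis_groupE /= => a0 _ nAx.
  have ab : a != pform m h.1 'X *+ 2.
    by apply: contra nAx => /eqP ab; apply: affine_sub_cent1.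
  by split; [apply: center_cent | apply: index_cent_cen].
have x0P : ((1%R, 0%R) : ext_heis D) \in (P :\: Y)%g.
  by rewrite in_setD heis_groupE in_setT oner_neq0.
have x0p : (((1%R, 0%R) : ext_heis D) ^+ p)%g = 1%g.
  by rewrite eh_expg_act pchar_Fp_0.
have [exO nexT nexN] := attachment_homology p_pr oZ ZP (heis_normal D)
  (index_heis D p_pr) (heis_class2 D) ZY iYZ affine_sub affine_abelian
  ZA centA centx x0P x0p affine_nsub_cent1 ntn.
split=> [nex|[->|->]] //.
have [->|it] := eqVneq i t; first by left.
have [->|iN] := eqVneq i (n%:Z - 1); first by right.
by case: nex; apply: exO.
Qed.

End PolynomialAction.

Theorem corollary1p7 (t k : nat) (hk : (0 < k)%N)
  (p : nat) (hp : prime p) (hpk : (2 * k + 3 < p)%N) :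
  exists (gT : finGroupType) (P : {group gT}),
    #|P| = (p ^ (2 * (t + k + 2)))%N /\
    forall i : int,
      (exists h : H_A_ge2 p P i, h != 0%R) <->
      (i = Posz t \/ i = Posz (k + t)).
Proof.
pose m := (2 * k + 2)%N.
(* The symplectic space Y / Z then has dimension m + 2 * t = 2 * (k + t).+1. *)
have p_odd : odd p by case: (even_prime hp) hpk => // ->; lia.
have m_even : ~~ odd m by rewrite /m oddD oddM.
have m_gt1 : (1 < m)%N by rewrite /m; lia.
have m_ltp : (m < p)%N by rewrite /m; lia.
exists (ext_heis (poly_heis t hp p_odd m_even m_ltp)), [set: _]%G; split.
  rewrite card_ext_heis // card_poly_heis // -expnS; congr (_ ^ _)%N.
  by rewrite /m; lia.
move=> i; have En : (2 * (k + t).+1 = m + 2 * t)%N by rewrite /m; lia.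
have ntn : t != (k + t).+1 by lia.
rewrite (poly_heis_homology hp p_odd m_even m_gt1 m_ltp En ntn).
by rewrite intS addrC addKr.
Qed.
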